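(* Let $p$ be an odd prime, $S$ a finite $p$-group and $\mathcal{F}$ a saturated fusion system on $S$. Let $E_1$ and $E_2$ be distinct $\mathcal{F}$-essential subgroups of $S$, both $\mathcal{F}$-characteristic in $S$ and both of sectional rank at most $3$. Then there exists $i\in\{1,2\}$ such that $O^{p'}(\mathrm{Out}_{\mathcal{F}}(E_i))\cong\mathrm{SL}_2(p)$.
   Context: Rank: minimal size of a generating set; a group has sectional rank at most $k$ if all its subgroups have rank at most $k$. For $P\le S$, $\mathrm{Aut}_{\mathcal{F}}(P)=\mathrm{Hom}_{\mathcal{F}}(P,P)$, $\mathrm{Out}_{\mathcal{F}}(P)=\mathrm{Aut}_{\mathcal{F}}(P)/\mathrm{Inn}(P)$, $P^{\mathcal{F}}=\{P\alpha:\alpha\in\mathrm{Hom}_{\mathcal{F}}(P,S)\}$. $E\le S$ is $\mathcal{F}$-essential if $C_S(P)\le P$ and $|N_S(E)|\ge|N_S(P)|$ for all $P\in E^{\mathcal{F}}$, and $\mathrm{Out}_{\mathcal{F}}(E)$ has a strongly $p$-embedded subgroup. $E$ is $\mathcal{F}$-characteristic in $S$ if $E$ is normalized by $\mathrm{Aut}_{\mathcal{F}}(S)$. $O^{p'}(G)$ is the subgroup of $G$ generated by its $p$-elements. *)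

(* Defs.v *)
From mathcomp Require Import all_boot all_order all_algebra all_fingroup all_solvable all_field.
Set Implicit Arguments. Unset Strict Implicit. Unset Printing Implicit Defensive.

(* Fusion systems on a finite group S (inside an ambient finGroupType gT).
   A fusion system is given by a boolean predicate F : {set gT} -> {ffun gT -> gT} -> bool,
   where "F P f" means: (the restriction to P of) f is a morphism of the fusion system
   from P into S, i.e. f|_P belongs to Hom_F(P, S).  Hom_F(P, Q) is then
   { f | F P f, f @: P \subset Q }. *)

Section Fusion.
Variable gT : finGroupType.
Open Scope group_scope.

Definition fmor := {set gT} -> {ffun gT -> gT} -> bool.

Definition is_fusion_system (S : {group gT}) (F : fmor) : Prop :=
  [/\
      (forall P f, F P f ->
         [/\ group_set P, P \subset S, ({in P &, {morph f : x y / x * y}}),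
             ({in P &, injective f}) & f @: P \subset S]),
      (forall P (f g : {ffun gT -> gT}), F P f -> {in P, f =1 g} -> F P g),
      (forall (P : {group gT}) s, P \subset S -> s \in S -> F P [ffun x => x ^ s]),
      (forall P Q f, F P f -> group_set Q -> Q \subset P -> F Q f) /\
      (forall P (f g : {ffun gT -> gT}), F P f -> F (f @: P) g -> F P [ffun x => g (f x)]) &
      (forall P f, F P f -> exists2 g, F (f @: P) g & {in P, forall x, g (f x) = x})].

Variables (p : nat) (S : {group gT}) (F : fmor).

Definition fconj (P Q : {set gT}) : Prop := exists2 f, F P f & f @: P = Q.

Definition fully_normalized (P : {set gT}) : Prop :=
  forall f, F P f -> #|'N_S(f @: P)| <= #|'N_S(P)|.

Definition fully_centralized (P : {set gT}) : Prop :=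
  forall f, F P f -> #|'C_S(f @: P)| <= #|'C_S(P)|.

Definition AutF (P : {set gT}) : {set {perm gT}} :=
  [set a in Aut P | F P [ffun x => a x]].

Definition AutS (T P : {set gT}) : {set {perm gT}} :=
  [set a in Aut P | [exists s in 'N_T(P), [forall x in P, a x == x ^ s]]].

Definition Inn (P : {set gT}) : {set {perm gT}} := AutS P P.

Definition OutF (P : {set gT}) := (AutF P / Inn P)%g.

(* N_phi = { g in N_S(P) | phi c_g phi^-1 \in Aut_S(phi(P)) } *)
Definition Nphi (P : {set gT}) (f : {ffun gT -> gT}) : {set gT} :=
  [set g in 'N_S(P) |
     [exists h in 'N_S(f @: P), [forall x in P, f (x ^ g) == f x ^ h]]].

(* Saturation (Sylow axiom + extension axiom, as in Aschbacher-Kessar-Oliver I.2.2) *)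
Definition saturated : Prop :=
  [/\ is_fusion_system S F,
      (forall P : {group gT}, P \subset S -> fully_normalized P ->
          fully_centralized P /\ p.-Sylow(AutF P) (AutS S P)) &
      (forall (P : {group gT}) f, F P f -> fully_centralized (f @: P) ->
          exists2 fb, F (Nphi P f) fb & {in P, forall x, fb x = f x})].

Definition F_characteristic (E : {set gT}) : Prop :=
  forall a, F S a -> a @: E = E.

End Fusion.

Open Scope group_scope.
Definition strongly_p_embedded (p : nat) (aT : finGroupType) (G H : {set aT}) : Prop :=
  [/\ H \proper G, p %| #|H| &
      forall g, g \in G :\: H -> ~~ (p %| #|H :&: H :^ g|)].

Definition Opprime (p : nat) (aT : finGroupType) (G : {set aT}) : {set aT} :=
  <<[set x in G | p.-elt x]>>%g.

Definition is_essential (gT : finGroupType) (p : nat) (S : {group gT}) (F : fmor gT)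
    (E : {set gT}) : Prop :=
  [/\ E \subset S,
      (forall f, F E f -> 'C_S(f @: E) \subset f @: E),
      fully_normalized S F E &
      exists H : {group (coset_of (Inn E))}, strongly_p_embedded p (OutF F E) H].

Definition rank_le (gT : finGroupType) (H : {set gT}) (k : nat) : Prop :=
  exists2 X : {set gT}, #|X| <= k & <<X>>%g = H.

(* sectional rank at most k (as in the paper: all subgroups have rank <= k) *)
Definition sectional_rank_le (gT : finGroupType) (E : {set gT}) (k : nat) : Prop :=
  forall H : {group gT}, H \subset E -> rank_le H k.

Definition SL2 (p : nat) : {set {'GL_2['F_p]}} :=
  [set g : {'GL_2['F_p]} | (\det (GLval g) == 1)%R].

(* Main.v *)
(* Put V = E / Phi(E), of order at most p^3.  The kernel of Out(E) on V is a normal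
   p-subgroup, hence trivial since Out(E) has a strongly p-embedded subgroup.  If V
   is reducible or of order less than p^3, then the group K generated by the
   p-elements of Out(E) is faithful on a section of V of order p^2, and two of its
   p-elements without common fixed vector generate SL_2(p).  If V is irreducible of
   order p^3, then Out(E) contains no transvections (the full group of transvections
   with a given axis would lie in all conjugates of the strongly embedded subgroup),
   so that |S : E| = p and S acts on V with a single Jordan block.

   Suppose that this last case holds for both E1 and E2, put A_1 = E1, B_1 = E2,
   A_{k+1} = Phi(A_k), B_{k+1} = Phi(B_k).  By induction on k, A_k / A_{k+1} is an
   irreducible Out(E1)-module of order p^3 on which S acts with a single Jordan block,
   likewise for B_k, and A_k /\ B_k has index p in A_k and B_k.  Indeed A_{k+1} and
   B_{k+1} are distinct, since otherwise S = E1 E2 would centralize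
   (A_k /\ B_k) / A_{k+1}; since A_k /\ B_k has rank at most 3, A_{k+1} /\ B_{k+1} has
   index p in both.  In particular A_{k+1} is nontrivial, and the bound on the rank
   forces the p-th power map to induce an isomorphism from A_k / A_{k+1} to
   A_{k+1} / A_{k+2}.  So the series never reaches 1, which is absurd. *)
Require Import Defs.
From mathcomp Require Import all_boot all_order all_algebra all_fingroup all_solvable all_field.
From mathcomp Require Import mxrepresentation mxabelem ring.
Set Implicit Arguments. Unset Strict Implicit. Unset Printing Implicit Defensive.
Import GroupScope.

(** * Power maps and the rank bound *)
Section RankBound.
Variables (gT : finGroupType) (p : nat).
Implicit Types A D H M N Q U : {group gT}.

Lemma abelem_quotient_card (k : nat) D U :
  prime p -> D \subset 'N(U) -> p.-abelem (D / U) -> rank_le D k ->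
  #|D / U| <= p ^ k.
Proof.
move=> p_pr nUD abD [X leXk defD].
have sXN : X \subset 'N(U) by rewrite -gen_subG defD.
have le_r : 'm(D / U) <= k.
  rewrite -defD quotient_gen //; apply: leq_trans (grank_min _) _.
  exact: leq_trans (leq_morphim _ _) leXk.
rewrite (card_pgroup (abelem_pgroup abD)) leq_exp2l ?prime_gt1 //.
by rewrite -(rank_abelem abD) -grank_abelian ?(abelem_abelian abD).
Qed.

Lemma central_prime_order_p4 Q N :
  prime p -> #|Q| = (p ^ 4)%N -> N \subset 'Z(Q) -> #|N| = p -> p.-abelem (Q / N) ->
  exists2 a, a \in Q :\: N & a \in 'Z(Q).
Proof.
move=> p_pr oQ sNZ oN abQ.
have pQ : p.-group Q by rewrite /pgroup oQ pnatX pnat_id.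
have sNQ : N \subset Q := subset_trans sNZ (center_sub Q).
have nNQ : Q \subset 'N(N).
  by apply: subset_trans (cent_sub _); rewrite centsC (subset_trans sNZ) ?subsetIr.
have [ZN | /subsetPn[a Za notNa]] := boolP ('Z(Q) \subset N); last first.
  by exists a => //; rewrite inE notNa (subsetP (center_sub Q)).
have defZ : 'Z(Q) = N by apply/eqP; rewrite eqEsubset ZN.
have sPhiN : 'Phi(Q) \subset N by apply: Phi_min abQ.
have nab : ~~ abelian Q.
  apply/negP=> abQ'; move/center_idP: abQ' => ZQ.
  have := oQ; rewrite -ZQ defZ oN => /eqP.
  by rewrite -{1}(expn1 p) eqn_exp2l ?prime_gt1.
have prN: prime #|N| by rewrite oN.
have sub_der : Q^`(1) \subset N.
  apply: subset_trans sPhiN; rewrite (Phi_joing pQ); exact: joing_subl.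
have derN : Q^`(1) = N.
  apply/eqP; rewrite eqEsubset sub_der; apply: contraR nab => nsN.
  have /prime_TIg := nsN; rewrite setIC => /(_ prN).
  by rewrite (setIidPl sub_der) => d1; apply/derG1P.
have PhiN : 'Phi(Q) = N.
  apply/eqP; rewrite eqEsubset sPhiN -{1}derN (Phi_joing pQ); exact: joing_subl.
have esQ : extraspecial Q.
  by split; [split; rewrite ?defZ | rewrite defZ].
have [n _] := card_extraspecial pQ esQ.
rewrite oQ => /eqP; rewrite eqn_exp2l ?prime_gt1 // => /eqP.
by case: n => [|[|n]].
Qed.

End RankBound.

Section PowerBound.
Variables (gT : finGroupType) (p : nat).
Implicit Types D M Q : {group gT}.

(** Suppose that [Q] has exponent [p]. Then abelian subgroups are elementary abelian, hence of order
    at most [p ^ 3]. Adjoining to the central subgroup ['Phi(Q)], of order [p ^ d], an element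
    outside it leaves only [d <= 2], and each of the three values is refuted. *)
Lemma nontrivial_pth_power Q :
  prime p -> p.-group Q -> 'Phi(Q) = 'Z(Q) -> p.-abelem 'Phi(Q) -> #|Q : 'Phi(Q)| = (p ^ 3)%N ->
  (forall D : {group gT}, D \subset Q -> p.-abelem D -> #|D| <= p ^ 3) ->
  exists2 x, x \in Q & x ^+ p != 1.
Proof.
move=> p_pr pQ defZ abPhi iQ rkQ.
have p_gt1 := prime_gt1 p_pr.
apply/exists_inP; apply: contraT; rewrite negb_exists_in => /forall_inP expQ.
have {}expQ x : x \in Q -> x ^+ p = 1 by move/expQ; rewrite negbK => /eqP.
have abelemQ (D : {group gT}) : D \subset Q -> abelian D -> p.-abelem D.
  by move=> sDQ cD; apply/(abelemP p_pr); split=> // x Dx; exact/expQ/(subsetP sDQ).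
set B := 'Phi(Q) in defZ abPhi iQ *.
have sBQ : B \subset Q := Phi_sub Q.
have nsBQ : B <| Q := Phi_normal Q.
have cBQ : Q \subset 'C(B) by rewrite centsC defZ subsetIr.
have [d oB] : {d | #|B| = (p ^ d)%N} by exists (logn p #|B|);
  exact: card_pgroup (abelem_pgroup abPhi).
have oQ : #|Q| = (p ^ (d + 3))%N by rewrite expnD -oB -iQ Lagrange.
have ord1 a : a \in Q -> a != 1 -> #[a] = p.
  by move=> Qa nta; apply/prime_nt_dvdP; rewrite ?order_eq1 // order_dvdn expQ.
have extend (D : {group gT}) (a : gT) : D \subset Q -> abelian D -> a \in 'C_Q(D) -> a \notin D ->
    [/\ <[a]> <*> D \subset Q, abelian (<[a]> <*> D) & #|<[a]> <*> D| = (p * #|D|)%N].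
  move=> sDQ cDD /setIP[Qa cDa] notDa; split.
  - by rewrite join_subG cycle_subG Qa.
  - by rewrite abelianY cycle_abelian cDD centsC cycle_subG.
  rewrite cent_joinEl ?cycle_subG //.
  have nta : a != 1 by apply: contraNneq notDa => ->.
  rewrite TI_cardMg ?[#|<[a]>|]ord1 //.
  by apply: prime_TIg; rewrite ?[#|_|]ord1 ?cycle_subG.
have sBZ : B \subset 'Z(Q) by rewrite defZ.
have cBB : abelian B := abelem_abelian abPhi.
have le_ext (a : gT) : a \in Q -> a \notin B -> (p ^ d.+1 <= p ^ 3)%N.
  move=> Qa Ba; have [|s ab o] := extend 'Phi(Q)%G a sBQ cBB _ Ba.
    by rewrite inE Qa (subsetP cBQ).
  by rewrite expnS -oB -o; apply: rkQ => //; apply: abelemQ.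
have [a0 Qa0 Ba0] : exists2 a, a \in Q & a \notin B.
  apply/subsetPn/negP; rewrite -indexg_eq1 iQ => /eqP p3.
  by have := ltn_expl 3 p_gt1; rewrite p3.
have d_le2 : d <= 2 by have := le_ext _ Qa0 Ba0; rewrite leq_exp2l.
have abQB : p.-abelem (Q / B) := Phi_quotient_abelem pQ.
case: d d_le2 oB oQ le_ext => [|[|[|//]]] _ oB oQ le_ext.
- have B1 : B = 1 := card1_trivg oB; move: (Ba0).
  have : Q^`(1) \subset B by rewrite /B (Phi_joing pQ) joing_subl.
  by rewrite {1}B1 => /trivgP/derG1P/center_idP => ZQ; rewrite defZ ZQ Qa0.
- have [a] := central_prime_order_p4 (N := 'Phi(Q)%G) p_pr oQ sBZ oB abQB.
  by rewrite inE -defZ => /andP[/negP].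
(* Case [d = 2]. The preceding lemma, applied modulo a central [M] of order [p], gives [a] outside
   [B] that is central modulo [M]. Its centralizer has order at least [p ^ 4], so it contains some
   [b] outside [<[a]> <*> B], and [a], [b], [B] generate an abelian group of order [p ^ 4]. *)
have [M sMB oM] : exists2 M : {group gT}, M \subset B & #|M| = p.
  have [|x Bx ox] := Cauchy p_pr (_ : p %| #|B|); first by rewrite oB dvdn_mulr.
  by exists <[x]>%G; rewrite ?cycle_subG.
have cMQ : Q \subset 'C(M) := subset_trans cBQ (centS sMB).
have nMQ : Q \subset 'N(M) := subset_trans cMQ (cent_sub M).
have sMQ := subset_trans sMB sBQ.
have nMB := subset_trans sBQ nMQ.
have [||||aM] := @central_prime_order_p4 _ p (Q / M)%G ('Phi(Q) / M)%G p_pr.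
- by rewrite card_quotient // -divgS // oQ oM -{2}(expn1 p) -expnB ?prime_gt0.
- by rewrite subsetI quotientS // quotient_cents // centsC.
- by rewrite card_quotient // -divgS // oB oM mulnK ?prime_gt0.
  by rewrite /= (isog_abelem (third_isog sMB _ nsBQ)) // /normal sMQ.
case/setDP=> /morphimP[a Na Qa ->] Ba /setIP[_ cQa].
have {}Ba : a \notin B by apply: contra Ba => Ba; exact: mem_quotient.
(* All conjugates of [a] lie in the coset of [M] containing [a]. *)
have icent : #|Q : 'C_Q[a]| <= p.
  rewrite index_cent1 -oM -(card_lcoset M a); apply: subset_leq_card.
  apply/subsetP=> _ /imsetP[y Qy ->]; rewrite mem_lcoset.
  rewrite -[a^-1 * _]/[~ a, y]; apply: coset_idr.
    by rewrite groupR // (subsetP nMQ).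
  rewrite morphR ?(subsetP nMQ) //; apply/eqP/commgP.
  by apply: (centP cQa); apply: mem_quotient.
have [|sD cD oD] := extend 'Phi(Q)%G a sBQ cBB _ Ba.
  by rewrite inE Qa (subsetP cBQ).
have [b /setIP[Qb cab] Db] : exists2 b, b \in 'C_Q[a] & b \notin <[a]> <*> B.
  apply/subsetPn/negP=> /subset_leq_card; rewrite oD oB -expnS; apply/negP.
  rewrite -ltnNge; have := Lagrange (subsetIl Q 'C[a]); rewrite oQ => e.
  rewrite ltnNge; apply/negP => le3.
  have := leq_mul le3 icent; rewrite e -expnSr leq_exp2l //.
have [|sD2 cD2 oD2] := extend [group of <[a]> <*> B] b sD cD _ Db.
  by rewrite inE Qb /= centY inE cent_cycle cab (subsetP cBQ).
have := rkQ _ sD2 (abelemQ _ sD2 cD2); rewrite oD2 oD oB -!expnS leq_exp2l //.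
Qed.

End PowerBound.

(** * Subgroups stable under a set of automorphisms *)

Section Stable.
Variables (gT : finGroupType) (L : {set {perm gT}}).
Implicit Types A B D E H S U X Y : {group gT}.

Definition stable (U : {set gT}) := [forall a in L, (a : {perm gT}) @: U == U].

Lemma stableP (U : {set gT}) :
  reflect {in L, forall (a : {perm gT}) x, x \in U -> a x \in U} (stable U).
Proof.
apply: (iffP forall_inP) => [stU a La x Ux | stU a La].
  by rewrite -{1}(eqP (stU a La)) imset_f.
rewrite eqEcard card_imset ?leqnn ?andbT; last exact: perm_inj.
by apply/subsetP=> _ /imsetP[x Ux ->]; exact: stU.
Qed.

Variable E : {group gT}.
Hypothesis sLE : L \subset Aut E.

(** Phrased with [autm], stability passes to Frattini subgroups, commutators and joins by the laws
    for images under morphisms. *)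
Lemma stable_morphP (U : {set gT}) : U \subset E ->
  reflect (forall a (La : a \in L), autm (subsetP sLE a La) @* U = U) (stable U).
Proof.
move=> sUE; apply: (iffP forall_inP) => stU a La.
  by rewrite morphimEsub //; exact/eqP/stU.
by rewrite -{2}(stU a La) morphimEsub.
Qed.

Lemma stable_Phi A : A \subset E -> stable A -> stable 'Phi(A).
Proof.
move=> sAE /(stable_morphP sAE) stA.
apply/(stable_morphP (subset_trans (Phi_sub A) sAE)) => a La.
by rewrite injm_Phi ?injm_autm // stA.
Qed.

Lemma stable_comm A B :
  A \subset E -> B \subset E -> stable A -> stable B -> stable [~: A, B].
Proof.
move=> sAE sBE /(stable_morphP sAE) stA /(stable_morphP sBE) stB.
apply/stable_morphP=> [|a La]; first by rewrite (subset_trans (commSg _ sAE)) //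
  (subset_trans (commgS _ sBE)) ?der_sub //; exact: der1_subG.
by rewrite morphimR // stA stB.
Qed.

Lemma stable_joing A B :
  A \subset E -> B \subset E -> stable A -> stable B -> stable (A <*> B).
Proof.
move=> sAE sBE /(stable_morphP sAE) stA /(stable_morphP sBE) stB.
apply/stable_morphP=> [|a La]; first by rewrite join_subG sAE.
by rewrite morphimY // stA stB.
Qed.

Lemma stable_refl : stable E.
Proof. by apply/(stable_morphP (subxx E)) => a La; rewrite im_autm. Qed.

Lemma stable_norm (S : {set gT}) A :
  S \subset 'N(E) -> conj_aut E @: S \subset L -> A \subset E -> stable A -> S \subset 'N(A).
Proof.
move=> /subsetP nES /subsetP sSL /subsetP sAE /stableP stA.
apply/subsetP=> s Ss; rewrite inE; apply/subsetP=> _ /imsetP[x Ax ->].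
have := stA _ (sSL _ (imset_f _ Ss)) x Ax.
by rewrite norm_conj_autE ?nES ?sAE.
Qed.

End Stable.

(** * Passing from the Frattini quotient of a group to that of its Frattini subgroup *)

Section CharacteristicStep.
Variables (gT : finGroupType) (p : nat) (L : {set {perm gT}}).
Implicit Types A B D E H S U X Y : {group gT}.

(* The last condition says that [S] acts on [A / 'Phi(A)] with a Jordan block of size 3. *)
Definition jordan_irr3 S A :=
  [/\ stable L A, #|A : 'Phi(A)| = (p ^ 3)%N,
      forall U, stable L U -> 'Phi(A) \subset U -> U \subset A -> U :=: 'Phi(A) \/ U :=: A
    & ~~ ([~: A, S, S] \subset 'Phi(A))].

(** With [B = 'Phi(A)] and [U] a maximal proper stable subgroup of [B], the [p]-th power map induces
    an isomorphism from [A / B] to [B / U] compatible with [L] and [S]. The rank bound then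
    identifies [U] with ['Phi(B)]. *)
Lemma jordan_irr3_Phi S E A :
  prime p -> odd p -> p.-group S -> E \subset S -> S \subset 'N(E) -> L \subset Aut E ->
  conj_aut E @: S \subset L -> A \subset E -> sectional_rank_le E 3 ->
  jordan_irr3 S A -> 'Phi(A) :!=: 1 -> jordan_irr3 S 'Phi(A).
Proof.
move=> p_pr p_odd pS sES nES sLE sSL sAE rkE [stA iA irrA nqA] ntB.
set B := 'Phi(A)%G; have {}ntB : gval B != 1 by []; change (jordan_irr3 S B).
have stn := stable_norm nES sSL.
have sBA : B \subset A := Phi_sub A.
have sBE := subset_trans sBA sAE.
have stB : stable L B := stable_Phi sLE sAE stA.
have pA : p.-group A := pgroupS sAE (pgroupS sES pS).
have pB := pgroupS sBA pA.
have [U maxU _] : {U : {group gT} | [max U | (U \proper B) && stable L U] & 1%G \subset U}.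
  apply: maxgroup_exists; rewrite proper1G ntB; apply/stableP => a La x /set1P->.
  have := morph1 (autm_morphism (subsetP sLE a La)).
  by rewrite /= autmE => ->; rewrite group1.
have [/andP[/andP[sUB nsBU] stU] maxU'] := maxgroupP maxU.
have {}maxU' Y : stable L Y -> U \subset Y -> Y \subset B -> Y :=: U \/ Y :=: B.
  move=> stY sUY sYB; have [sBY | nsBY] := boolP (B \subset Y).
    by right; apply/eqP; rewrite eqEsubset sYB.
  by left; apply: maxU'; rewrite // properE sYB nsBY.
have sUA := subset_trans sUB sBA; have sUE := subset_trans sUA sAE.
have nUS : S \subset 'N(U) := stn U sUE stU.
have nUA : A \subset 'N(U) := subset_trans sAE (subset_trans sES nUS).
have nUB := subset_trans sBA nUA.
have nAS : S \subset 'N(A) := stn A sAE stA.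
have nBS : S \subset 'N(B) := stn B sBE stB.
have nsUA : U <| A by rewrite /normal sUA.
have nsUB : U <| B by rewrite /normal sUB.
have pQ : p.-group (A / U) := quotient_pgroup U pA.
have defPhi : 'Phi(A / U) = B / U by rewrite -(quotient_Phi pA).
(* This consequence of maximality is used twice: [[~: B, A]] fails to cover [B / U] by nilpotence
   and ['Phi(B)] fails because it consists of nongenerators. So [B / U] is elementary abelian and
   central in [A / U]. *)
have below Y : stable L Y -> Y \subset B -> ~~ (B \subset U <*> Y) -> Y \subset U.
  move=> stY sYB nsB.
  have [||| <-| e] := maxU' (U <*> Y)%G.
  - by apply: (stable_joing sLE) => //; apply: subset_trans sYB sBE.
  - exact: joing_subl.
  - by rewrite join_subG sUB.
  - exact: joing_subr.
  by rewrite -{1}e subxx in nsB.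
have ntBU : B / U != 1 by rewrite -subG1 quotient_sub1.
have cBA : [~: B, A] \subset U.
  have sBAB : [~: B, A] \subset B by rewrite commg_subl gFnorm.
  apply: (below [~: B, A]%G) => //; first exact: (stable_comm sLE).
  have : [~: B / U, A / U] \proper B / U.
    apply: (nil_comm_properl (pgroup_nil pQ)); rewrite ?quotientS //.
    by rewrite subsetI subxx quotient_norms ?gFnorm.
  apply: contraL => sB; rewrite properE negb_and negbK orbC -quotientR //.
  by rewrite -(quotientYidl (subset_trans sBAB nUB)) quotientS.
have sPhiBU : 'Phi(B) \subset U.
  apply: (below 'Phi(B)%G); rewrite ?Phi_sub //; first exact: (stable_Phi sLE).
  apply/negP=> sB; case/negP: nsBU.
  rewrite -[U : {set _}]genGid (@Phi_nongen _ B U) //.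
  by apply/eqP; rewrite eqEsubset join_subG Phi_sub sUB joingC.
have abBU : p.-abelem (B / U).
  rewrite -trivg_Phi ?quotient_pgroup // -(quotient_Phi pB) // -subG1 quotient_sub1 //.
  by rewrite (subset_trans sPhiBU) ?normG.
have iQ : #|A / U : 'Phi(A / U)| = (p ^ 3)%N.
  by rewrite defPhi index_quotient_eq // subIset // sUB orbT.
have cB : B / U \subset 'C(A / U) by rewrite quotient_cents2.
have expQ x : x \in B -> x ^+ p \in U.
  move=> Bx; have /(abelemP p_pr)[_ eB] := abBU.
  apply: coset_idr; first by rewrite groupX ?(subsetP nUB).
  by rewrite morphX ?(subsetP nUB) //; apply: eB; apply: mem_quotient.
have [x Ax ntx] : exists2 x, x \in A & x ^+ p \notin U.
  have : exists2 y, y \in A / U & y ^+ p != 1.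
    (* Irreducibility makes [Z] equal to [B] or [A]. If it is [B], centre and Frattini subgroup of
       [A / U] coincide and [nontrivial_pth_power] applies. If it is [A], then [A / U] is abelian,
       and exponent [p] would make its Frattini subgroup [B / U] trivial. *)
    pose Z := (A :&: coset U @*^-1 'Z(A / U))%G.
    have inZ x : (x \in Z) = (x \in A) && [forall y in A, [~ x, y] \in U].
      rewrite inE; case Ax: (x \in A) => //=.
      have Nx := subsetP nUA x Ax.
      apply/morphpreP/forall_inP => [[_ /setIP[_ /centP cx]] y Ay | cx].
        have Ny := subsetP nUA y Ay; apply: coset_idr; first by rewrite groupR.
        by rewrite morphR //; apply/eqP/commgP/cx; apply: mem_quotient.
      split=> //; apply/setIP; split; first exact: mem_quotient.
      apply/centP => _ /morphimP[y Ny Ay ->].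
      by apply/commgP; rewrite -morphR //; apply/eqP/coset_id/cx.
    have stZ : stable L Z.
      apply/stableP => a La x; rewrite !inZ => /andP[Ax /forall_inP cx].
      have aA := stableP _ _ stA a La; rewrite aA //=.
      apply/forall_inP => y Ay.
      have /imsetP[z Az ->] : y \in [set a z | z in A] by rewrite (eqP (forall_inP stA a La)).
      have := stableP _ _ stU a La _ (cx z Az).
      by rewrite -!(autmE (subsetP sLE a La)) morphR ?(subsetP sAE).
    have [||eZ | eZ] := irrA Z stZ; rewrite ?subsetIl //.
    - apply/subsetP => b Bb; rewrite inZ (subsetP sBA) //=; apply/forall_inP => y Ay.
      by apply: (subsetP cBA); exact: mem_commg.
    - apply: (@nontrivial_pth_power _ p (A / U)%G) => //.
      + rewrite defPhi -[gval B]eZ /= (setIidPr _) ?cosetpreK //.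
        by rewrite sub_cosetpre_quo ?center_sub.
      + by rewrite defPhi.
      + move=> _ /inv_quotientS[] // D -> sUD sDA abD.
        apply: abelem_quotient_card => //; first exact: subset_trans nUA.
        exact/rkE/(subset_trans sDA).
    apply/exists_inP; apply: contraR ntBU; rewrite negb_exists_in => /forall_inP e1.
    rewrite -defPhi (trivg_Phi pQ); apply/(abelemP p_pr); split; last first.
      by move=> y /e1; rewrite negbK => /eqP.
    rewrite [abelian _]quotient_cents2 // gen_subG; apply/subsetP => _ /imset2P[y z Ay Az ->].
    by move: Ay; rewrite -{1}eZ inZ => /andP[_ /forall_inP]; apply.
  case=> _ /morphimP[x Nx Ax ->]; rewrite -morphX // => ntx; exists x => //.
  by apply: contra ntx => Ux; apply/eqP/coset_id.
pose f (y : coset_of U) := y ^+ p.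
(* Commutators are central of exponent dividing [p], and the error term is a commutator raised to
   the power [p (p - 1) / 2], a multiple of [p] as [p] is odd. *)
have fM : {in A / U &, {morph f : y z / y * z}}.
  move=> y z Qy Qz; rewrite /f.
  have Qyz : [~ z, y] \in B / U.
    rewrite -defPhi (Phi_joing pQ); apply: (subsetP (joing_subl _ _)); exact: mem_commg.
  have cyz w : w \in A / U -> commute w [~ z, y] by move=> Qw;
    apply/esym/(centP (subsetP cB _ Qyz)).
  rewrite expMg_Rmul; [|exact: cyz|exact: cyz]. rewrite bin2odd // expgM.
  by have /(abelemP p_pr)[_ /(_ _ Qyz) ->] := abBU; rewrite expg1n mulg1.
pose phi := Morphism fM.
have phiE x0 : x0 \in A -> phi (coset U x0) = coset U (x0 ^+ p).
  by move=> Ax0; rewrite /= /f morphX ?(subsetP nUA).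
(* [K] is stable and contains [B]; it misses [x], so irreducibility gives [K = B]. *)
pose K := (coset U @*^-1 'ker phi)%G.
have inK y : (y \in K) = (y \in A) && (y ^+ p \in U).
  apply/idP/andP => [|[Ay Uy]].
    case/morphpreP=> Ny ky; have Ay : y \in A.
      by rewrite -(quotientGK nsUA) mem_morphpre // (dom_ker ky).
    split=> //; have := mker ky; rewrite phiE //; apply: coset_idr.
    exact: groupX.
  have Ny := subsetP nUA y Ay; apply: mem_morphpre => //.
  by apply/kerP; rewrite ?mem_quotient // phiE // coset_id.
have aX a (La : a \in L) y : y \in A -> a (y ^+ p) = a y ^+ p.
  by move=> Ay; rewrite -!(autmE (subsetP sLE a La)) morphX ?(subsetP sAE).
have stK : stable L K.
  apply/stableP => a La y; rewrite !inK => /andP[Ay Uy].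
  by rewrite -aX // (stableP _ _ stA) //= (stableP _ _ stU).
have defK : K :=: B.
  have [||//|eK] := irrA K stK.
  - by apply/subsetP=> b Bb; rewrite inK (subsetP sBA) ?expQ.
  - by apply/subsetP=> b; rewrite inK => /andP[].
  by move: Ax; rewrite -{1}eK inK (negbTE ntx) andbF.
have kphi : 'ker phi = B / U by rewrite -defK cosetpreK.
have ophi : #|phi @* (A / U)| = (p ^ 3)%N by rewrite card_morphim setIid kphi -defPhi.
(* [P] is stable between [U] and [B]; the image of [phi] has order [p ^ 3], so [P] is not [U] and
   must be [B]. *)
pose P := (coset U @*^-1 (phi @* (A / U)))%G.
have sphi : phi @* (A / U) \subset B / U.
  apply/subsetP => _ /morphimP[y _ Qy ->]; rewrite -defPhi (Phi_joing pQ).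
  have := Mho_p_elt 1 Qy (mem_p_elt pQ Qy).
  by rewrite expn1; apply/subsetP/joing_subr.
have sUP : U \subset P := sub_cosetpre _.
have sPB : P \subset B by rewrite sub_cosetpre_quo.
have stP : stable L P.
  apply/stableP => a La y Py; have By := subsetP sPB y Py.
  case/morphpreP: Py => Ny /morphimP[_ _ /morphimP[z Nz Az ->] e].
  have Aaz : a z \in A by rewrite (stableP _ _ stA).
  have Aay : a y \in A by rewrite (stableP _ _ stA) ?(subsetP sBA).
  apply: mem_morphpre; first by rewrite (subsetP nUA).
  have Qaz : coset U (a z) \in A / U by exact: mem_quotient.
  suff e2 : coset U (a y) = phi (coset U (a z)).
    by have := mem_morphim phi Qaz Qaz; rewrite -e2.
  rewrite phiE // -aX //; apply/rcoset_kercosetP; rewrite ?(subsetP nUA) ?aX ?groupX //.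
  rewrite -aX // mem_rcoset -!(autmE (subsetP sLE a La)) -morphV -?morphM ?groupV ?groupX
    ?(subsetP sAE) ?(subsetP sBA y By) //.
  apply: (stableP _ _ stU) => //; rewrite -mem_rcoset; apply/rcoset_kercosetP => //.
    by rewrite groupX.
  by rewrite e phiE.
have defP : phi @* (A / U) = B / U.
  have [eP | <-] := maxU' P stP sUP sPB; last by rewrite cosetpreK.
  have ePU : phi @* (A / U) = P / U by rewrite cosetpreK.
  have p3 := ophi; rewrite ePU eP trivg_quotient cards1 in p3.
  by have := ltn_expl 3 (prime_gt1 p_pr); rewrite -p3.
have oBU : #|B / U| = (p ^ 3)%N by rewrite -defP.
(* The rank bound gives [#|B / 'Phi(B)| <= p ^ 3 = #|B / U|], while ['Phi(B)] is already contained
   in [U]. *)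
have defU : 'Phi(B) = U.
  have nPB : B \subset 'N('Phi(B)) by rewrite gFnorm.
  have := abelem_quotient_card p_pr nPB (Phi_quotient_abelem pB) (rkE _ sBE).
  rewrite -oBU !card_quotient // => le_i; apply/eqP; rewrite eqEcard sPhiBU.
  rewrite -(leq_pmul2r (indexg_gt0 B 'Phi(B))) Lagrange ?Phi_sub //.
  by rewrite -{1}(Lagrange sUB) leq_pmul2l.
split=> //.
- by rewrite defU -card_quotient.
- by move=> Y stY; rewrite defU; exact: maxU'.
rewrite defU; apply: contra nqA => qB.
have nQS : S / U \subset 'N(A / U) by rewrite quotient_norms.
(* Powers commute with conjugation, so [phi] sends [[~: A, S, S]] into [[~: B, S, S]] modulo [U]. If
   the latter vanished, the former would lie in the kernel [B / U], against the Jordan block on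
   [A / B]. *)
have phiR (X : {group coset_of U}) : X \subset A / U -> S / U \subset 'N(X) ->
    phi @* [~: X, S / U] \subset [~: phi @* X, S / U].
  move=> sXQ nXS.
  rewrite morphim_gen; last first.
    apply/subsetP => _ /imset2P[y s Xy Ss ->]; rewrite (subsetP sXQ) //.
    by rewrite groupM ?groupV ?memJ_norm // (subsetP nXS).
  rewrite gen_subG; apply/subsetP => _ /morphimP[_ _ /imset2P[y s Xy Ss ->] ->].
  have Qy := subsetP sXQ y Xy.
  have -> : phi [~ y, s] = [~ phi y, s].
    have e : phi (y ^ s) = phi y ^ s by rewrite /= /f conjXg.
    by rewrite !commgEl morphM ?groupV ?memJ_norm ?(subsetP nQS) // morphV // e.
  by rewrite mem_commg ?mem_morphim.
have sQSQ : [~: A / U, S / U] \subset A / U by rewrite commg_subl.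
have : phi @* [~: A / U, S / U, S / U] \subset [1].
  apply: subset_trans (phiR [~: A / U, S / U]%G _ _) _ => //.
    exact: commg_normr.
  apply: subset_trans (commSg _ (phiR (A / U)%G _ _)) _ => //.
  have nBSU : [~: B, S] \subset 'N(U) by apply: subset_trans nUB; rewrite commg_subl.
  rewrite defP -!quotientR // quotient_sub1 //.
  by apply: subset_trans qB (normG U).
move=> k1; have : [~: A / U, S / U, S / U] \subset 'ker phi.
  by rewrite ker_trivg_morphim k1 (subset_trans _ sQSQ) // commg_subl commg_normr.
have sASA : [~: A, S] \subset A by rewrite commg_subl.
have nASU : [~: A, S] \subset 'N(U) := subset_trans sASA nUA.
rewrite kphi -!quotientR // quotientSGK //.
apply: subset_trans nASU; rewrite commg_subl; exact: commg_normr.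
Qed.
End CharacteristicStep.

(** * The amalgam *)

Section Amalgam.
Variables (gT : finGroupType) (p : nat).
Implicit Types A B E S T : {group gT}.

(** By nilpotence the commutator with [S] is a proper subgroup of [A / T], which has prime order. *)
Lemma comm_normal_index_p S A T :
  prime p -> p.-group S -> A \subset S -> S \subset 'N(A) -> S \subset 'N(T) ->
  T \subset A -> #|A : T| = p -> [~: A, S] \subset T.
Proof.
move=> p_pr pS sAS nAS nTS sTA iTA.
have nTA := subset_trans sAS nTS.
have sASA : [~: A, S] \subset A by rewrite commg_subl.
have oAT : #|A / T| = p by rewrite card_quotient.
have : [~: A / T, S / T] \proper A / T.
  apply: (nil_comm_properl (pgroup_nil (quotient_pgroup T pS))); rewrite ?quotientS //.
    by rewrite -cardG_gt1 oAT prime_gt1.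
  by rewrite subsetI subxx quotient_norms.
case/andP => s ns; rewrite -quotient_sub1 ?(subset_trans sASA) // quotientR //.
have prA : prime #|A / T| by rewrite oAT.
by have := prime_TIg prA ns; rewrite (setIidPr s) => ->.
Qed.

Lemma jordan_irr3_central (L : {set {perm gT}}) S E A :
  p.-group S -> E \subset S -> S \subset 'N(E) -> L \subset Aut E ->
  conj_aut E @: S \subset L -> A \subset E -> prime p ->
  jordan_irr3 p L S A -> [~: A, E] \subset 'Phi(A).
Proof.
move=> pS sES nES sLE sSL sAE p_pr [stA iA irrA _].
have pE := pgroupS sES pS; have pA := pgroupS sAE pE.
have nAE : E \subset 'N(A) := subset_trans sES (stable_norm nES sSL sAE stA).
have sAEA : [~: A, E] \subset A by rewrite commg_subl.
have [||| <- | eA] := irrA ('Phi(A) <*> [~: A, E])%G.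
- have sPE := subset_trans (Phi_sub A) sAE.
  apply: (stable_joing sLE) => //=; first exact: subset_trans sAEA sAE.
    exact: (stable_Phi sLE).
  by apply: (stable_comm sLE) => //; exact: (stable_refl sLE).
- exact: joing_subl.
- by rewrite join_subG Phi_sub.
- exact: joing_subr.
have := Phi_nongen eA; rewrite genGid => eA'.
have ntA : A :!=: 1.
  have := Lagrange (Phi_sub A); rewrite iA => oA; rewrite -cardG_gt1 -oA.
  by rewrite (@leq_trans (p ^ 3)) ?leq_pmull // -{1}(expn0 p) ltn_exp2l ?prime_gt1.
have := nil_comm_properl (pgroup_nil pE) sAE ntA _ (A := E).
by rewrite subsetI subxx nAE eA' properxx => /(_ isT).
Qed.

Lemma no_jordan_amalgam (L1 L2 : {set {perm gT}}) S E1 E2 :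
  prime p -> odd p -> p.-group S -> E1 \subset S -> E2 \subset S ->
  #|S : E1| = p -> #|S : E2| = p -> E1 :!=: E2 ->
  L1 \subset Aut E1 -> L2 \subset Aut E2 ->
  conj_aut E1 @: S \subset L1 -> conj_aut E2 @: S \subset L2 ->
  sectional_rank_le E1 3 -> sectional_rank_le E2 3 ->
  jordan_irr3 p L1 S E1 -> jordan_irr3 p L2 S E2 -> False.
Proof.
move=> p_pr p_odd pS sE1 sE2 iE1 iE2 neqE sL1 sL2 sSL1 sSL2 rk1 rk2 j1 j2.
have p_gt1 := prime_gt1 p_pr.
have max1 : maximal E1 S by apply: p_index_maximal; rewrite ?iE1.
have max2 : maximal E2 S by apply: p_index_maximal; rewrite ?iE2.
have nE1 : S \subset 'N(E1) := normal_norm (p_maximal_normal pS max1).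
have nE2 : S \subset 'N(E2) := normal_norm (p_maximal_normal pS max2).
have nsE21 : ~~ (E2 \subset E1).
  apply: contra neqE => s21; rewrite eq_sym eqEcard s21 -(leq_pmul2r (prime_gt0 p_pr)).
  by rewrite -{1}iE1 -iE2 !Lagrange /=.
have defS : E1 * E2 = S by apply: mulg_normal_maximal; rewrite /normal ?sE1.
have i12 : #|E1 : E1 :&: E2| = p.
  have nsE2 : E2 <| S by rewrite /normal sE2.
  by rewrite indexgI -indexMg -(normC (subset_trans sE1 nE2)) defS.
have i21 : #|E2 : E1 :&: E2| = p by rewrite setIC indexgI -indexMg defS.
(* Infinite descent: every such pair yields a pair of the same kind with smaller [A]. *)
suff IH n A B : #|A| < n -> A \subset E1 -> B \subset E2 ->
    jordan_irr3 p L1 S A -> jordan_irr3 p L2 S B ->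
    #|A : A :&: B| = p -> #|B : A :&: B| = p -> False.
  exact: IH _ _ _ (ltnSn #|E1|) (subxx E1) (subxx E2) j1 j2 i12 i21.
elim: n A B => // n IHn A B ltn sA sB jA jB iA iB.
have [stA oA irrA nqA] := jA; have [stB oB irrB nqB] := jB.
have sAS := subset_trans sA sE1; have sBS := subset_trans sB sE2.
have pA := pgroupS sAS pS; have pB := pgroupS sBS pS.
pose T := (A :&: B)%G.
have sTA : T \subset A := subsetIl A B.
have sTB : T \subset B := subsetIr A B.
have pT := pgroupS sTA pA.
have nAS := stable_norm nE1 sSL1 sA stA.
have nBS := stable_norm nE2 sSL2 sB stB.
have nTS : S \subset 'N(T) by rewrite normsI.
have [sPA sPB] : 'Phi(A) \subset T /\ 'Phi(B) \subset T.
  have abT (X : {group gT}) : X \subset S -> p.-group X -> #|X : T| = p -> 'Phi(X) \subset T.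
    move=> sX pX iX; have nTX := subset_trans sX nTS.
    by apply: (Phi_min pX) => //; apply: prime_abelem; rewrite // card_quotient.
  by split; apply: abT.
have cA := jordan_irr3_central pS sE1 nE1 sL1 sSL1 sA p_pr jA.
have cB := jordan_irr3_central pS sE2 nE2 sL2 sSL2 sB p_pr jB.
have nPAS : S \subset 'N('Phi(A)) := gFnorm_trans _ nAS.
have nPBS : S \subset 'N('Phi(B)) := gFnorm_trans _ nBS.
(* If they agreed, [E1] and [E2], hence [S], would centralize [T / 'Phi(A)]. Since [[~: A, S]] lies
   in [T], this would make [[~: A, S, S]] vanish modulo ['Phi(A)]. *)
have neqP : 'Phi(A) != 'Phi(B).
  apply: contra nqA => /eqP eP.
  apply: subset_trans (commSg _ (comm_normal_index_p p_pr pS sAS nAS nTS sTA iA)) _.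
  rewrite -quotient_cents2 ?(subset_trans sTA) ?(subset_trans sAS) //.
  rewrite centsC -defS quotientMl ?(subset_trans sE1) // mul_subG //.
    rewrite centsC quotient_cents2 ?(subset_trans sTA) ?(subset_trans sAS) ?(subset_trans sE1) //.
    exact: subset_trans (commSg _ sTA) cA.
  rewrite centsC quotient_cents2 ?(subset_trans sTA) ?(subset_trans sAS) ?(subset_trans sE2) //= eP.
  exact: subset_trans (commSg _ sTB) cB.
have iTA : #|T : 'Phi(A)| = (p ^ 2)%N.
  apply/eqP; rewrite -(eqn_pmul2l (prime_gt0 p_pr)) -{1}iA Lagrange_index //.
  by rewrite oA expnS.
have iTB : #|T : 'Phi(B)| = (p ^ 2)%N.
  apply/eqP; rewrite -(eqn_pmul2l (prime_gt0 p_pr)) -{1}iB Lagrange_index //.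
  by rewrite oB expnS.
have eqo : #|'Phi(A)| = #|'Phi(B)|.
  apply/eqP; rewrite -(eqn_pmul2r (_ : 0 < p ^ 2)) ?expn_gt0 ?prime_gt0 //.
  by rewrite -{1}iTA -iTB !Lagrange.
pose D := ('Phi(A) :&: 'Phi(B))%G.
(* [D] contains ['Phi(T)], so the rank of [T] bounds the index. With [#|T : 'Phi(A)| = p ^ 2] this
   leaves index at most [p] for [D] in ['Phi(A)], and index 1 is excluded by [neqP]. *)
have leT : #|T : D| <= p ^ 3.
  have sPD : 'Phi(T) \subset D by rewrite subsetI (PhiS pA) ?(PhiS pB).
  apply: leq_trans (dvdn_leq _ (indexgS T sPD)) _ => //.
  rewrite -card_quotient ?gFnorm //; apply: abelem_quotient_card => //.
  - exact: gFnorm.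
  - exact: Phi_quotient_abelem.
  - exact/rk1/(subset_trans sTA).
have iD : #|'Phi(A) : D| = p.
  have le_p : #|'Phi(A) : D| <= p.
    rewrite -(leq_pmul2l (_ : 0 < p ^ 2)) ?expn_gt0 ?prime_gt0 //.
    by rewrite -{1}iTA Lagrange_index ?subsetIl // -expnSr.
  have pPA := pgroupS (Phi_sub A) pA.
  have : p.-nat #|'Phi(A) : D| by exact: pnat_dvd (dvdn_indexg _ _) pPA.
  case/p_natP => [[|k] e].
    have eDP : D :=: 'Phi(A) := index1g (subsetIl _ _) e.
    case/negP: neqP; rewrite eqEcard eqo leqnn andbT -eDP; exact: subsetIr.
  move: le_p; rewrite e -{2}(expn1 p) leq_exp2l //; case: k {e} => //.
have iD' : #|'Phi(B) : D| = p.
  apply/eqP; rewrite -(eqn_pmul2l (cardG_gt0 D)) Lagrange ?subsetIr // -eqo -{1}iD.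
  by rewrite Lagrange ?subsetIl.
have nontriv (X : {group gT}) : #|X : D| = p -> X :!=: 1.
  move=> iX; apply/negP => /eqP X1; have := dvdn_indexg X D.
  by rewrite iX X1 cards1 dvdn1 => /eqP p1; rewrite p1 in p_gt1.
apply: (IHn 'Phi(A)%G 'Phi(B)%G _ _ _ _ _ iD iD').
- rewrite -ltnS; apply: leq_trans ltn; rewrite ltnS.
  rewrite -(Lagrange (Phi_sub A)) oA -{1}(muln1 #|'Phi(A)|) ltn_pmul2l //.
  by rewrite -{1}(expn0 p) ltn_exp2l.
- exact: subset_trans (Phi_sub A) sA.
- exact: subset_trans (Phi_sub B) sB.
- exact: (jordan_irr3_Phi (E := E1)) (nontriv _ iD).
- exact: (jordan_irr3_Phi (E := E2)) (nontriv _ iD').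
Qed.
End Amalgam.

(** * Strongly p-embedded subgroups *)

Section StronglyEmbedded.
Variables (gT : finGroupType) (p : nat) (H M : {group gT}).
Hypotheses (p_pr : prime p) (seM : strongly_p_embedded p H M).
Implicit Types N P Q : {group gT}.

(** Such an [N] lies in [M :&: M :^ g] for any [g] outside [M]. *)
Lemma strongly_embedded_normal N : N <| H -> N \subset M -> ~~ (p %| #|N|).
Proof.
have [/andP[_ /subsetPn[g Hg Mg]] _ se] := seM.
case/andP=> _ /subsetP nNH sNM; apply: contra (se g _); last by rewrite inE Mg.
move/dvdn_trans; apply; apply: cardSg; rewrite subsetI sNM -{1}(normP (nNH g Hg)).
by rewrite conjSg.
Qed.

Lemma strongly_embedded_norm P : p.-group P -> P \subset M -> P :!=: 1 -> 'N_H(P) \subset M.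
Proof.
have [_ _ se] := seM; move=> pP sPM ntP; apply/subsetP=> g /setIP[Hg nPg].
apply: contraT => Mg; have := se g; rewrite inE Mg Hg => /(_ isT); apply: contraNT => _.
have [_ pdvd _] := pgroup_pdiv pP ntP; apply: dvdn_trans pdvd (cardSg _).
by rewrite subsetI sPM -{1}(normP nPg) conjSg.
Qed.

(** The centre of [Q] centralizes a nontrivial element of [Q :&: M], so it lies in [M]; then [Q]
    normalizes a nontrivial [p]-subgroup of [M]. *)
Lemma strongly_embedded_absorb Q :
  p.-group Q -> Q \subset H -> Q :&: M != 1 -> Q \subset M.
Proof.
move=> pQ sQH; rewrite -subG1 => /subsetPn[q /setIP[Qq Mq] /set1P/eqP ntq].
have pq : p.-group <[q]> := mem_p_elt pQ Qq.
have ntZ : 'Z(Q) != 1.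
  rewrite (center_nil_eq1 (pgroup_nil pQ)); apply: contraNneq ntq => Q1.
  by move: Qq; rewrite Q1 => /set1P ->.
have sZM : 'Z(Q) \subset M.
  apply: subset_trans (strongly_embedded_norm pq _ _); rewrite ?cycle_subG ?cycle_eq1 //.
  rewrite subsetI (subset_trans (center_sub Q)) //= cents_norm //.
  by rewrite centsC cycle_subG (subsetP _ _ Qq) // centsC subsetIr.
apply: subset_trans (strongly_embedded_norm (pgroupS (center_sub Q) pQ) sZM ntZ).
by rewrite subsetI sQH gFnorm.
Qed.

(** A Sylow subgroup of [H] containing one of [M] is absorbed by [M], so [M] contains a Sylow
    subgroup of [H]. *)
Lemma strongly_embedded_Jsub P : p.-group P -> P \subset H -> exists2 h, h \in H & P :^ h \subset M.
Proof.
have [/andP[sMH _] pM _] := seM => pP sPH.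
have [R sylR] := Sylow_exists p M; have [sRM pR _] := and3P sylR.
have [Q sylQ sRQ] := Sylow_superset (subset_trans sRM sMH) pR.
have [sQH pQ _] := and3P sylQ.
have sQM : Q \subset M.
  apply: strongly_embedded_absorb => //; apply: contraL pM => /eqP QM1.
  have R1 : R :=: 1 by apply/trivgP; rewrite -QM1 subsetI sRQ.
  by rewrite -p'natE // -partn_eq1 // -(card_Hall sylR) R1 cards1.
by have [h Hh sPQ] := Sylow_Jsub sylQ sPH pP; exists h => //; apply: subset_trans sPQ sQM.
Qed.

Lemma strongly_embedded_core : 'O_p(H) = 1.
Proof.
apply/eqP; apply: contraT => nt.
have [h Hh] := strongly_embedded_Jsub (pcore_pgroup p H) (pcore_sub p H).
rewrite (normP (subsetP (gFnorm _ _) h Hh)) => sM.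
have := strongly_embedded_normal (pcore_normal p H) sM.
by have [_ -> _] := pgroup_pdiv (pcore_pgroup p H) nt.
Qed.

(** Otherwise the normal closure of [P] in [H] would lie in [M]. *)
Lemma strongly_embedded_conj P :
  p.-group P -> P \subset H -> P :!=: 1 -> exists2 h, h \in H & ~~ (P :^ h \subset M).
Proof.
move=> pP sPH ntP; apply/exists_inP; apply: contraT; rewrite negb_exists_in => /forall_inP sPM.
pose N := <<class_support P H>>%G.
have nsN : N <| H.
  rewrite /normal gen_subG class_support_subG // norms_gen //.
  by rewrite class_support_norm.
have sNM : N \subset M.
  rewrite gen_subG; apply/subsetP => _ /imset2P[x h Px Hh ->].
  by move: (sPM h Hh); rewrite negbK => /subsetP; apply; rewrite memJ_conjg.
have := strongly_embedded_normal nsN sNM; apply: contraNT => _.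
have [_ pdvd _] := pgroup_pdiv pP ntP; apply: dvdn_trans pdvd (cardSg _).
apply: sub_gen; apply/subsetP => x Px; rewrite -(conjg1 x); exact: memJ_class_support.
Qed.

End StronglyEmbedded.

(** * Linear groups over the prime field *)

Section LinearGroups.
Import GRing.Theory.
Local Open Scope ring_scope.
Variable p : nat.
Hypothesis p_pr : prime p.

Lemma Frobenius_sub1 n (x : 'M['F_p]_n.+1) k : (x - 1) ^+ (p ^ k) = x ^+ (p ^ k) - 1.
Proof.
have pcharM : p \in [pchar 'M['F_p]_n.+1]%R by rewrite (pchar_lalg 'M['F_p]_n.+1) pchar_Fp.
elim: k => [|k IHk]; first by rewrite !expr1.
rewrite expnSr !exprM IHk -(pFrobenius_autE pcharM) pFrobenius_autB_comm; last exact: commr1.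
by rewrite pFrobenius_aut1.
Qed.

Lemma GLval_exp n (u : {'GL_n.+1['F_p]}) m : GLval (u ^+ m)%g = GLval u ^+ m.
Proof. by elim: m => [|m IHm] //; rewrite expgS exprS GL_ME IHm. Qed.

Lemma p_elt_nilpotent n (u : {'GL_n.+1['F_p]}) :
  p.-elt u -> exists k, (GLval u - 1) ^+ (p ^ k) = 0.
Proof.
case/p_natP=> k ou; exists k; rewrite Frobenius_sub1 -GLval_exp -ou expg_order.
by rewrite GL_1E subrr.
Qed.

Lemma p_elt_fixes n (u : {'GL_n.+1['F_p]}) :
  p.-elt u -> exists2 v : 'rV_n.+1, v != 0 & v *m GLval u = v.
Proof.
case/p_elt_nilpotent=> k uk.
have : \det (GLval u - 1) == 0.
  have detX m : \det ((GLval u - 1) ^+ m) = \det (GLval u - 1) ^+ m.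
    by elim: m => [|m IHm]; rewrite ?det1 // !exprS -IHm -det_mulmx.
  by have /eqP := detX (p ^ k)%N; rewrite uk det0 eq_sym expf_eq0 => /andP[].
case/det0P=> v nzv; rewrite mulmxBr mulmx1 => /eqP; rewrite subr_eq0 => /eqP uv.
by exists v.
Qed.

(** Raising to the power [p ^ k] is the identity on the prime field, so the determinant equals that
    of a trivial power of [u]. *)
Lemma p_elt_det n (u : {'GL_n.+1['F_p]}) : p.-elt u -> \det (GLval u) = 1.
Proof.
case/p_natP=> k ou; have : \det (GLval (u ^+ (p ^ k))) = 1.
  by rewrite -ou expg_order GL_1E det1.
rewrite GLval_exp; have -> : \det (GLval u ^+ (p ^ k)) = \det (GLval u) ^+ (p ^ k).
  by elim: (p ^ k)%N => [|m IHm]; rewrite ?det1 // !exprS -IHm -det_mulmx.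
suff -> (a : 'F_p) : a ^+ (p ^ k) = a by [].
elim: k {ou} => [|k IHk]; first by rewrite expr1.
by have := expf_card a; rewrite card_Fp // expnS exprM => ->.
Qed.

Lemma det_mx2 (x : 'M['F_p]_2) : \det x = x 0 0 * x 1 1 - x 0 1 * x 1 0.
Proof.
rewrite (expand_det_row _ 0) !big_ord_recl big_ord0 addr0 /cofactor !det_mx11 !mxE /=.
rewrite expr0 expr1 mul1r mulN1r mulrN.
by congr (_ * x _ _ - x _ _ * x _ _); apply: val_inj.
Qed.

Definition mx2 (a b c d : 'F_p) : 'M['F_p]_2 :=
  \matrix_(i, j) (if i == 0 then if j == 0 then a else b else if j == 0 then c else d).

Lemma mx2E (x : 'M['F_p]_2) : x = mx2 (x 0 0) (x 0 1) (x 1 0) (x 1 1).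
Proof. by apply/matrixP=> -[[|[|//]] ?] [[|[|//]] ?]; rewrite !mxE /=; congr (x _ _);
  apply: val_inj. Qed.

Lemma mul_mx2 a b c d a' b' c' d' :
  mx2 a b c d *m mx2 a' b' c' d' =
    mx2 (a * a' + b * c') (a * b' + b * d') (c * a' + d * c') (c * b' + d * d').
Proof.
by apply/matrixP=> -[[|[|//]] ?] [[|[|//]] ?]; rewrite !mxE !big_ord_recl big_ord0 !mxE /= addr0.
Qed.

(** Powers of the two given matrices exhaust both unitriangular groups because the field is prime,
    and these generate the matrices of determinant 1. *)
Lemma det1_mx2_generated (P : 'M['F_p]_2 -> Prop) r s :
    r != 0 -> s != 0 -> (forall x y, P x -> P y -> P (x *m y)) -> P 1 ->
    P (mx2 1 0 s 1) -> P (mx2 1 r 0 1) ->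
  forall x, \det x = 1 -> P x.
Proof.
move=> nzr nzs PM P1 Ps Pr.
have P_l t : P (mx2 1 0 t 1).
  have -> : t = s *+ (t / s : 'F_p).
    by rewrite -mulr_natr natr_Zp mulrC divfK.
  elim: (nat_of_ord _) => [|m IHm].
    suff -> : mx2 1 0 (s *+ 0) 1 = 1 by [].
    by rewrite [RHS]mx2E !mxE.
  have := PM _ _ Ps IHm; rewrite mul_mx2 !(mul1r, mulr1, mul0r, mulr0, add0r, addr0).
  by rewrite mulrS.
have P_u t : P (mx2 1 t 0 1).
  have -> : t = r *+ (t / r : 'F_p).
    by rewrite -mulr_natr natr_Zp mulrC divfK.
  elim: (nat_of_ord _) => [|m IHm].
    suff -> : mx2 1 (r *+ 0) 0 1 = 1 by [].
    by rewrite [RHS]mx2E !mxE.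
  have := PM _ _ Pr IHm; rewrite mul_mx2 !(mul1r, mulr1, mul0r, mulr0, add0r, addr0).
  by rewrite mulrS addrC.
have P_c x : \det x = 1 -> x 1 0 != 0 -> P x.
  rewrite det_mx2 [in P x](mx2E x); move: (x 0 0) (x 0 1) (x 1 0) (x 1 1) => a b c d det1 nzc.
  (* Upper, lower, upper factorization, with parameters read off from the diagonal; the entry [b] is
     then forced by the determinant. *)
  have := PM _ _ (PM _ _ (P_u ((a - 1) / c)) (P_l c)) (P_u ((d - 1) / c)).
  have -> : b = (a * d - 1) / c by rewrite -det1; field.
  by rewrite !mul_mx2; congr (P (mx2 _ _ _ _)); field.
move=> x detx; have [c0 | nzc] := eqVneq (x 1 0) 0; last exact: P_c.
have nza : x 0 0 != 0.
  by apply: contra_eq_neq detx => a0; rewrite det_mx2 a0 c0 mul0r mulr0 subr0 eq_sym oner_eq0.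
have -> : x = mx2 1 0 (-1) 1 *m (mx2 1 0 1 1 *m x).
  rewrite mulmxA mul_mx2 !(mul1r, mulr1, mul0r, mulr0, add0r, addr0) addNr.
  by rewrite -[mx2 _ _ _ _](_ : 1 = _) ?mul1mx // [LHS]mx2E !mxE.
apply: PM => //; apply: P_c; first by rewrite det_mulmx detx mulr1 det_mx2 !mxE /= mulr1
  mul0r subr0.
by rewrite [x in mx2 _ _ _ _ *m x]mx2E mul_mx2 mxE /= c0 mul1r mulr0 addr0.
Qed.

Lemma SL2_group_set : group_set (SL2 p).
Proof.
apply/group_setP; split=> [|u v]; first by rewrite inE GL_1E det1.
by rewrite !inE GL_ME => /eqP du /eqP dv; rewrite det_mulmx du dv mulr1.
Qed.

(** Two [p]-elements [x] and [y] fixing independent vectors [v1] and [v2] become opposite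
    unitriangular matrices in the basis [v1], [v2], and these generate everything of determinant
    1. *)
Lemma Opprime_GL2 (G : {group {'GL_2['F_p]}}) :
  Opprime p G = G -> ~~ p.-group G -> G :=: SL2 p.
Proof.
move=> defG npG.
have sGSL : G \subset SL2 p.
  rewrite -defG -[SL2 p]/(gval (Group SL2_group_set)) gen_subG.
  by apply/subsetP=> u; rewrite inE => /andP[Gu pu]; rewrite inE p_elt_det.
have [x Gx /andP[px ntx]] : exists2 x, x \in G & p.-elt x && (x != 1%g).
  apply/exists_inP; apply: contraR npG; rewrite negb_exists_in => /forall_inP triv.
  suff -> : G :=: 1%g by exact: pgroup1.
  apply/trivgP; rewrite -defG gen_subG; apply/subsetP => u; rewrite inE => /andP[Gu pu].
  by have := triv u Gu; rewrite pu negbK => /eqP ->; rewrite group1.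
have [v1 nzv1 xv1] := p_elt_fixes px.
(* If all [p]-elements fixed [v1], so would [G]. Every [u] in [G] would have determinant 1 and
   eigenvalue 1, so [u - 1] would square to zero and [u ^+ p = 1], making [G] a [p]-group. *)
have [y Gy /andP[py yv1]] : exists2 y, y \in G & p.-elt y && (v1 *m GLval y != v1).
  apply/exists_inP; apply: contraR npG; rewrite negb_exists_in => /forall_inP fix1.
  have stab : group_set [set u : {'GL_2['F_p]} | v1 *m GLval u == v1].
    apply/group_setP; split=> [|u v]; first by rewrite inE GL_1E mulmx1.
    by rewrite !inE GL_MxE mulmxA => /eqP -> /eqP ->.
  have sGst : G \subset Group stab.
    rewrite -defG gen_subG; apply/subsetP => u; rewrite inE => /andP[Gu pu].
    by have := fix1 u Gu; rewrite pu negbK inE.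
  apply/pgroupP => q q_pr /(Cauchy q_pr)[u Gu ou].
  have Gu' := subsetP sGst u Gu; rewrite inE in Gu'; move/eqP: Gu' => uv1.
  have du : \det (GLval u) = 1 by have := subsetP sGSL u Gu; rewrite inE => /eqP.
  have d0 : \det (GLval u - 1) = 0.
    by apply/eqP/det0P; exists v1; rewrite // mulmxBr mulmx1 uv1 subrr.
  have uu : (GLval u - 1) *m (GLval u - 1) = 0.
    move: d0 du; rewrite [GLval u]mx2E; move: (GLval u 0 0) (GLval u 0 1) (GLval u 1 0)
      (GLval u 1 1) => a b c d.
    rewrite !det_mx2 !mxE /= !subr0 => d0 d1.
    have dE : d = 1 - (a - 1).
      apply/eqP; rewrite -subr_eq0; apply/eqP.
      have -> : d - (1 - (a - 1)) = (a * d - b * c - 1) - ((a - 1) * (d - 1) - b * c) by ring.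
      by rewrite d0 d1 !subrr.
    rewrite {d}dE in d0 d1 *.
    have e0 : (a - 1) * (a - 1) + b * c = 0 by rewrite -[RHS]oppr0 -d0; ring.
    apply/matrixP=> -[[|[|//]] ?] [[|[|//]] ?];
      rewrite !mxE !big_ord_recl big_ord0 !mxE /= ?subr0 addr0.
    - exact: e0.
    - by ring.
    - by ring.
    - by rewrite -[RHS]e0; ring.
  have up : (u ^+ p = 1)%g.
    apply: val_inj; have := Frobenius_sub1 (GLval u) 1; rewrite expn1 -GLval_exp.
    have nilp m : (1 < m)%N -> (GLval u - 1) ^+ m = 0.
      have uu' : (GLval u - 1) * (GLval u - 1) = 0 by exact: uu.
      by case: m => [|[|m]] // _; rewrite !exprS mulrA uu' mul0r.
    rewrite nilp ?prime_gt1 // => /esym/eqP.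
    by rewrite subr_eq0 => /eqP.
  by rewrite inE /= -(dvdn_prime2 q_pr p_pr) -ou order_dvdn up.
have [v2 nzv2 yv2] := p_elt_fixes py.
pose B : 'M['F_p]_2 := \matrix_(i < 2) (if i == 0 then v1 else v2).
have B0 : row 0 B = v1 by rewrite rowK.
have B1 : row 1 B = v2 by rewrite rowK.
have uB : B \in unitmx.
  rewrite unitmxE unitfE; apply/negP => /det0P[w nzw wB].
  have {}wB : w 0 0 *: v1 + w 0 1 *: v2 = 0.
    have l1 : lift ord0 ord0 = 1 :> 'I_2 by apply: val_inj.
    by rewrite -wB mulmx_sum_row !big_ord_recl big_ord0 addr0 l1 B0 B1.
  have [w00 | nzw0] := eqVneq (w 0 0) 0.
    have [w10 | nzw1] := eqVneq (w 0 1) 0.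
      case/eqP: nzw; apply/rowP=> -[[|[|//]] i]; rewrite [RHS]mxE.
        by rewrite -[RHS]w00; congr (w _ _); apply: val_inj.
      by rewrite -[RHS]w10; congr (w _ _); apply: val_inj.
    move/eqP: wB; rewrite w00 scale0r add0r scaler_eq0 (negPf nzw1) /=; exact/negP.
  case/eqP: yv1; have -> : v1 = - (w 0 1 / w 0 0) *: v2.
    apply: (scalerI nzw0); rewrite scalerA mulrN mulrCA divff // mulr1 scaleNr.
    by apply/eqP; rewrite -addr_eq0 wB.
  by rewrite -scalemxAl yv2.
(* [P m] says that [m] is the matrix of an element of [G] in the basis formed by the rows of [B]. *)
pose P (m : 'M['F_p]_2) := exists2 g, g \in G & B *m GLval g = m *m B.
have PB (g : {'GL_2['F_p]}) : g \in G -> P (B *m GLval g *m invmx B).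
  by move=> Gg; exists g; rewrite // mulmxKV.
have detB (g : {'GL_2['F_p]}) : g \in SL2 p -> \det (B *m GLval g *m invmx B) = 1.
  rewrite inE => /eqP detg; rewrite !det_mulmx detg mulr1 det_inv divff //.
  by rewrite -unitfE -unitmxE.
have rowB i (g : {'GL_2['F_p]}) : row i B *m GLval g = row i B ->
  row i (B *m GLval g *m invmx B) = row i 1%:M.
  by rewrite !row_mul => ->; rewrite -row_mul mulmxV.
pose X := B *m GLval x *m invmx B; pose Y := B *m GLval y *m invmx B.
have X0 j : X 0 j = (0 == j)%:R.
  have e : row 0 B *m GLval x = row 0 B by rewrite B0.
  by have /rowP/(_ j) := rowB 0 x e; rewrite mxE => ->; rewrite !mxE.
have Y1 j : Y 1 j = (1 == j)%:R.
  have e : row 1 B *m GLval y = row 1 B by rewrite B1.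
  by have /rowP/(_ j) := rowB 1 y e; rewrite mxE => ->; rewrite !mxE.
have slG g : g \in G -> g \in SL2 p by exact/subsetP.
have detX := detB x (slG x Gx); have detY := detB y (slG y Gy).
have one_eq (g : {'GL_2['F_p]}) : B *m GLval g *m invmx B = 1%:M -> g = 1%g.
  move=> e; apply: val_inj; have : B *m GLval g = B by rewrite -[LHS](mulmxKV uB) e mul1mx.
  by move/(congr1 (mulmx (invmx B))); rewrite mulKmx // mulVmx.
have eX : X = mx2 1 0 (X 1 0) 1.
  move: detX; rewrite -/X det_mx2 !X0 /= mul1r mul0r subr0 => X11.
  by rewrite {1}[X]mx2E !X0 X11.
have eY : Y = mx2 1 (Y 0 1) 0 1.
  move: detY; rewrite -/Y det_mx2 !Y1 /= mulr1 mulr0 subr0 => Y00.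
  by rewrite {1}[Y]mx2E !Y1 Y00.
have mx2_1 : mx2 1 0 0 1 = 1%:M by rewrite [RHS]mx2E !mxE.
have nzX : X 1 0 != 0.
  by apply: contraNneq ntx => X10; apply/eqP/one_eq; rewrite -/X eX X10 mx2_1.
have nzY : Y 0 1 != 0.
  apply: contraNneq yv1 => Y01; rewrite (one_eq y) ?GL_1E ?mulmx1 //.
  by rewrite -/Y eY Y01 mx2_1.
have P_SL : forall m, \det m = 1 -> P m.
  apply: (det1_mx2_generated nzY nzX); rewrite -?eX -?eY; try exact: PB.
    move=> m m' [g Gg eg] [h Gh eh]; exists (g * h)%g; first exact: groupM.
    by rewrite GL_MxE mulmxA eg -!mulmxA eh.
  by exists 1%g; rewrite ?group1 // GL_1E mulmx1 mul1mx.
apply/eqP; rewrite eqEsubset sGSL; apply/subsetP=> g SLg.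
have [h Gh] := P_SL _ (detB g SLg).
rewrite mulmxKV // => /(congr1 (mulmx (invmx B))); rewrite !mulKmx // => e.
by rewrite (_ : g = h) //; apply: val_inj.
Qed.
End LinearGroups.

(** * Transvections in three-dimensional linear groups *)

Section Transvections.
Import GRing.Theory.
Local Open Scope ring_scope.
Variables (p : nat) (H M : {group {'GL_3['F_p]}}).
Hypotheses (p_pr : prime p) (seM : strongly_p_embedded p H M).
Implicit Types (c : 'cV['F_p]_3) (r : 'rV['F_p]_3) (g : {'GL_3['F_p]}).

Lemma GLmulgV g : GLval g *m GLval g^-1 = 1%:M :> 'M_3.
Proof. by rewrite -[LHS]/(GLval (g * g^-1)%g) mulgV. Qed.

Lemma GLmulVg g : GLval g^-1 *m GLval g = 1%:M :> 'M_3.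
Proof. by rewrite -[LHS]/(GLval (g^-1 * g)%g) mulVg. Qed.

(* [1 + c *m r], with [r *m c = 0], is the transvection with centre [r] and axis the kernel
  of [c]. *)
Definition in_H c r := [exists g in H, GLval g == 1 + c *m r].

Lemma in_HP c r : reflect (exists2 g, g \in H & GLval g = 1 + c *m r) (in_H c r).
Proof. by apply: (iffP exists_inP) => -[g Hg] /eqP; exists g. Qed.

Lemma transvection_mul c1 r1 c2 r2 :
  r1 *m c2 = 0 -> (1 + c1 *m r1) * (1 + c2 *m r2) = 1 + (c1 *m r1 + c2 *m r2) :> 'M_3.
Proof.
move=> r1c2; rewrite mulrDl !mul1r mulrDr mulr1 -[c1 *m r1 * _]mulmxA (mulmxA r1) r1c2.
by rewrite mul0mx mulmx0 addr0 addrAC -addrA addrA.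
Qed.

Lemma in_H0 c : in_H c 0.
Proof. by apply/in_HP; exists 1%g; rewrite ?group1 // mulmx0 addr0. Qed.

Lemma in_HD c r1 r2 : r1 *m c = 0 -> in_H c r1 -> in_H c r2 -> in_H c (r1 + r2).
Proof.
move=> r1c /in_HP[g Hg eg] /in_HP[h Hh eh]; apply/in_HP; exists (g * h)%g; rewrite ?groupM //.
by rewrite GL_ME eg eh transvection_mul // mulmxDr.
Qed.

Lemma in_HZ c r (a : 'F_p) : r *m c = 0 -> in_H c r -> in_H c (a *: r).
Proof.
move=> rc Hr; rewrite -[a]natr_Zp scaler_nat; elim: (nat_of_ord a) => [|m IHm].
  by rewrite mulr0n in_H0.
by rewrite mulrS in_HD.
Qed.

Lemma in_H_conj c r g : g \in H -> in_H c r -> in_H (GLval g^-1 *m c) (r *m GLval g).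
Proof.
move=> Hg /in_HP[h Hh eh]; apply/in_HP; exists (h ^ g)%g; first by rewrite groupJ.
rewrite conjgE !GL_ME eh mulrDl mul1r mulrDr -GL_ME mulVg GL_1E; congr (1 + _).
by rewrite -[LHS]/(_ *m (_ *m _)) !mulmxA.
Qed.

Lemma transvection_neq1 c r : c != 0 -> r != 0 -> 1 + c *m r != 1 :> 'M_3.
Proof.
move=> nzc nzr; rewrite -subr_eq0 addrC addKr.
have /rV0Pn[j rj] := nzr; have /cV0Pn[i ci] := nzc.
apply: contraNneq rj => /matrixP/(_ i j); rewrite !mxE big_ord1 => /eqP.
by rewrite mulf_eq0 (negPf ci).
Qed.

Definition axis_group c :=
  [set g in H | [exists r, (r *m c == 0) && (GLval g == 1 + c *m r)]].

Lemma axis_groupP c g :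
  reflect [/\ g \in H & exists2 r, r *m c = 0 & GLval g = 1 + c *m r] (g \in axis_group c).
Proof.
rewrite inE; apply: (iffP andP) => -[Hg]; first by case/existsP=> r /andP[/eqP ? /eqP ?];
  split=> //; exists r.
by case=> r rc eg; split=> //; apply/existsP; exists r; rewrite rc eg !eqxx.
Qed.

Lemma axis_group_set c : group_set (axis_group c).
Proof.
apply/group_setP; split=> [|g h].
  by apply/axis_groupP; split=> //; exists 0; rewrite ?mul0mx // mulmx0 addr0.
case/axis_groupP=> Hg [r rc eg] /axis_groupP[Hh [s sc eh]]; apply/axis_groupP.
split; first exact: groupM.
by exists (r + s); rewrite ?mulmxDl ?rc ?sc ?addr0 // GL_ME eg eh transvection_mul // mulmxDr.
Qed.
Canonical axis_group_group c := Group (axis_group_set c).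

Lemma axis_pgroup c : p.-group (axis_group c).
Proof.
apply/pgroupP=> q q_pr /(Cauchy q_pr)[g /axis_groupP[_ [r rc eg]] og].
have gm m : GLval (g ^+ m)%g = 1 + c *m (r *+ m).
  elim: m => [|m IHm]; first by rewrite mulr0n mulmx0 addr0.
  by rewrite expgS GL_ME IHm eg transvection_mul // mulrS mulmxDr.
have gp : (g ^+ p = 1)%g.
  apply: val_inj; rewrite /= gm -scaler_nat pchar_Fp_0 // scale0r mulmx0 addr0 //.
by rewrite inE /= -(dvdn_prime2 q_pr p_pr) -og order_dvdn gp.
Qed.

Lemma common_kernel c c' : exists2 r : 'rV_3, r != 0 & (r *m c == 0) && (r *m c' == 0).
Proof.
have : kermx (row_mx c c') != 0.
  rewrite -mxrank_eq0 mxrank_ker -lt0n subn_gt0;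
    exact: leq_ltn_trans (rank_leq_col (row_mx c c')) _.
case/rowV0Pn=> r /sub_kermxP; rewrite mul_mx_row => /eqP; rewrite row_mx_eq0 => e nzr.
by exists r.
Qed.

(* Two full axis groups contain commuting elements with a common centre, so all of them
   lie in the same conjugate of [M]. *)
Lemma no_full_axis c : c != 0 -> (forall r, r *m c = 0 -> in_H c r) -> False.
Proof.
have mulV g d : GLval g *m (GLval g^-1 *m d) = d :> 'cV_3.
  by rewrite mulmxA GLmulgV mul1mx.
have full_conj (d : 'cV['F_p]_3) g : g \in H -> (forall r, r *m d = 0 -> in_H d r) ->
    forall r, r *m (GLval g^-1 *m d) = 0 -> in_H (GLval g^-1 *m d) r.
  move=> Hg full r rd; have -> : r = r *m GLval g^-1 *m GLval g.
    by rewrite -mulmxA GLmulVg mulmx1.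
  by apply: in_H_conj => //; apply: full; rewrite -mulmxA.
have sub_axisJ (d : 'cV['F_p]_3) g : g \in H ->
  axis_group d :^ g \subset axis_group (GLval g^-1 *m d).
  move=> Hg; apply/subsetP => _ /imsetP[h /axis_groupP[Hh [r rd eh]] ->].
  apply/axis_groupP; split; first by rewrite groupJ.
  exists (r *m GLval g); first by rewrite -mulmxA mulV.
  rewrite conjgE !GL_ME eh mulrDl mul1r mulrDr -GL_ME mulVg GL_1E; congr (1 + _).
  by rewrite -[LHS]/(_ *m (_ *m _)) !mulmxA.
have axisJ (d : 'cV['F_p]_3) g : g \in H -> axis_group d :^ g = axis_group (GLval g^-1 *m d).
  move=> Hg; apply/eqP; rewrite eqEsubset sub_axisJ //= -sub_conjgV.
  apply: subset_trans (sub_axisJ _ _ (groupVr Hg)) _.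
  by rewrite invgK mulV.
have nz_conj (d : 'cV['F_p]_3) g : d != 0 -> GLval g^-1 *m d != 0.
  by apply: contraNneq => e; rewrite -(mulV g d) e mulmx0.
have nt_axis (d : 'cV['F_p]_3) : d != 0 -> (forall r, r *m d = 0 -> in_H d r) ->
  axis_group d != 1%g.
  move=> nzd fulld; have [r nzr /andP[/eqP rd _]] := common_kernel d d.
  have /in_HP[z Hz ez] := fulld r rd.
  rewrite -subG1; apply/subsetPn; exists z; first by apply/axis_groupP; split=> //; exists r.
  by rewrite inE; apply: contraNneq (transvection_neq1 nzd nzr) => z1; rewrite -ez z1.
move=> nzc fullc.
have sAH d : axis_group d \subset H by apply/subsetP=> g /axis_groupP[].
(* Replace [c] by a conjugate whose axis group lies in [M]; a further conjugate [d] has axis group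
   outside [M]. *)
have [h Hh] := strongly_embedded_Jsub p_pr seM (axis_pgroup c) (sAH c).
rewrite axisJ //; have {nzc} := nz_conj c h nzc; have {fullc} := full_conj c h Hh fullc.
move: (GLval h^-1 *m c) => {}c fullc nzc sAM.
have [g Hg] := strongly_embedded_conj seM (axis_pgroup c) (sAH c) (nt_axis c nzc fullc).
rewrite axisJ //; have := nz_conj c g nzc; have := full_conj c g Hg fullc.
move: (GLval g^-1 *m c) => d fulld nzd; case/negP.
apply: (strongly_embedded_absorb seM (axis_pgroup d) (sAH d)).
(* The transvections [z] and [w] with common centre [r] commute, so [w] normalizes [<[z]>] and lies
   in [M]. Absorption then forces the axis group of [d] into [M]. *)
have [r nzr /andP[/eqP rc /eqP rd]] := common_kernel c d.
have /in_HP[z Hz ez] := fullc r rc; have /in_HP[w Hw ew] := fulld r rd.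
have Az : z \in axis_group c by apply/axis_groupP; split=> //; exists r.
have Aw : w \in axis_group d by apply/axis_groupP; split=> //; exists r.
have nt (x : {'GL_3['F_p]}) e : e != 0 -> GLval x = 1 + e *m r -> x != 1%g.
  move=> nze ex; apply: contraNneq (transvection_neq1 nze nzr) => x1.
  by rewrite -ex x1.
have wM : w \in M.
  have Mz : z \in M by exact: (subsetP sAM).
  have pz : p.-group <[z]> := mem_p_elt (axis_pgroup c) Az.
  apply: (subsetP (strongly_embedded_norm seM pz _ _)); rewrite ?cycle_subG ?cycle_eq1 ?(nt z c) //.
  rewrite inE Hw (subsetP (cent_sub _)) // cent_cycle; apply/cent1P/val_inj.
  have e : GLval (w * z)%g = GLval (z * w)%g.
    by rewrite !GL_ME ew ez !transvection_mul //; congr (1 + _); exact: addrC.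
  exact: e.
rewrite -subG1; apply/subsetPn; exists w; first by rewrite inE Aw.
by rewrite inE (nt w d).
Qed.

Lemma sub_rank2 m (r1 r2 w : 'rV['F_p]_3) (A : 'M_(3, m)) :
    \rank (col_mx r1 r2) = 2%N -> \rank A = 1%N ->
    r1 *m A = 0 -> r2 *m A = 0 -> w *m A = 0 -> (w <= col_mx r1 r2)%MS.
Proof.
move=> rk12 rkA e1 e2 ew.
have sk : (col_mx r1 r2 <= kermx A)%MS.
  by apply/sub_kermxP; rewrite mul_col_mx e1 e2 col_mx0.
have := mxrank_leqif_sup sk; rewrite mxrank_ker rkA rk12 => /leqifP.
case: ifP => // sk' _; apply: submx_trans sk'; exact/sub_kermxP.
Qed.

Lemma rank_cV1 c : c != 0 -> \rank c = 1%N.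
Proof. by move=> nzc; apply/eqP; rewrite eqn_leq rank_leq_col lt0n mxrank_eq0. Qed.

(** A transvection with axis [c2] and centre a multiple of [r1] is produced; together with the one
    of centre [r2] it makes the axis group of [c2] full. If [r2 *m c1 = 0], then [c1] and [c2] are
    proportional. Otherwise conjugating the second transvection by the first keeps its axis and
    shifts its centre by a multiple of [r1]. *)
Lemma no_orthogonal_pair c1 r1 c2 r2 :
  r1 *m c1 = 0 -> r2 *m c2 = 0 -> c1 != 0 -> c2 != 0 -> in_H c1 r1 -> in_H c2 r2 ->
  r1 *m c2 = 0 -> \rank (col_mx r1 r2) = 2%N -> False.
Proof.
move=> r1c1 r2c2 nzc1 nzc2 H1 H2 r1c2 rk12.
have [a nza Ha] : exists2 a, a != 0 & in_H c2 (a *: r1).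
  have [r2c1 | nz21] := eqVneq (r2 *m c1) 0.
    pose K := kermx (col_mx r1 r2)^T.
    have inK c : r1 *m c = 0 -> r2 *m c = 0 -> (c^T <= K)%MS.
      move=> e1 e2; apply/sub_kermxP.
      by rewrite -trmx_mul mul_col_mx e1 e2 col_mx0 trmx0.
    have sK : (K <= c2^T)%MS.
      have := mxrank_leqif_sup (inK _ r1c2 r2c2).
      rewrite mxrank_ker !mxrank_tr rk12 rank_cV1 // => /leqifP.
      by case: ifP.
    have /sub_rVP[a ea] := submx_trans (inK _ r1c1 r2c1) sK.
    have {}ea : c1 = a *: c2 by apply: trmx_inj; rewrite ea linearZ.
    exists a; first by apply: contraNneq nzc1 => a0; rewrite ea a0 scale0r.
    by have /in_HP[g Hg eg] := H1; apply/in_HP; exists g; rewrite // eg ea -scalemxAl scalemxAr.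
  pose a := (r2 *m c1) 0 0; have r2c1 : r2 *m c1 = a%:M by rewrite [LHS]mx11_scalar.
  exists a; first by apply: contraNneq nz21 => a0; rewrite r2c1 a0 raddf0.
  have /in_HP[g Hg eg] := H1; have := in_H_conj Hg H2.
  have -> : GLval g^-1 *m c2 = c2.
    have gc : GLval g *m c2 = c2 by rewrite eg mulmxDl mul1mx -mulmxA r1c2 mulmx0 addr0.
    by rewrite -{1}gc mulmxA GLmulVg mul1mx.
  have -> : r2 *m GLval g = r2 + a *: r1 by rewrite eg mulmxDr mulmx1 mulmxA r2c1 mul_scalar_mx.
  move=> Hs; have -> : a *: r1 = -1 *: r2 + (r2 + a *: r1) by rewrite scaleN1r addKr.
  by rewrite in_HD ?in_HZ // -scalemxAl r2c2 scaler0.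
have H1' : in_H c2 r1.
  by rewrite -[r1](scalerK nza) in_HZ // -scalemxAl r1c2 scaler0.
apply: (no_full_axis nzc2) => r rc2.
have /sub_addsmxP[[x y] ->] : (r <= r1 + r2)%MS by rewrite addsmxE (sub_rank2 _ (rank_cV1 nzc2)).
rewrite [x]mx11_scalar [y]mx11_scalar !mul_scalar_mx.
by rewrite in_HD ?in_HZ // -scalemxAl r1c2 scaler0.
Qed.

Lemma rank1_factor (A : 'M['F_p]_3) :
  \rank A = 1%N -> exists c r, A = c *m r.
Proof.
move=> rkA; have := mulmx_base A.
by move: (\rank A) rkA (col_base A) (row_base A) => _ -> c r <-; exists c, r.
Qed.

(** The powers of [c *m r] are its multiples by powers of the scalar [r *m c]. *)
Lemma nilpotent_rank1 c r k : (c *m r) ^+ k = 0 -> c != 0 -> r != 0 -> r *m c = 0.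
Proof.
move=> nil nzc nzr; rewrite [r *m c]mx11_scalar; set a := _ 0 0.
suff -> : a = 0 by rewrite raddf0.
apply/eqP; apply: contraT => nza.
have pow m : (c *m r) ^+ m.+1 = a ^+ m *: (c *m r).
  elim: m => [|m IHm]; first by rewrite expr1 expr0 scale1r.
  rewrite exprS IHm -[LHS]/(_ *m _) -scalemxAr -mulmxA (mulmxA r) [r *m c]mx11_scalar -/a.
  by rewrite mul_scalar_mx -scalemxAr scalerA exprSr.
have nzcr : c *m r != 0.
  by have := transvection_neq1 nzc nzr; rewrite -subr_eq0 addrC addKr.
case: k nil => [|k]; first by rewrite expr0 => /eqP; rewrite oner_eq0.
by rewrite pow => /eqP; rewrite scaler_eq0 expf_eq0 (negPf nza) andbF (negPf nzcr).
Qed.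

(** Irreducibility supplies three transvections with independent centres. Unless two of them already
    form an orthogonal pair, conjugating the second by a transvection with the axis and centre of
    the first moves its centre into the axis of the third, which creates such a pair. *)
Lemma irreducible_no_transvection t :
  (forall U : 'M['F_p]_3, {in H, forall g, (U *m GLval g <= U)%MS} -> U != 0 -> row_full U) ->
  t \in H -> p.-elt t -> \rank (GLval t - 1) = 1%N -> False.
Proof.
move=> irrH Ht pt rkt.
have trP g : g \in H -> p.-elt g -> \rank (GLval g - 1) = 1%N ->
  exists c r, [/\ GLval g - 1 = c *m r, r *m c = 0, c != 0, r != 0 & in_H c r].
  move=> Hg pg rkg; have [c [r e]] := rank1_factor rkg; exists c, r.
  have nzc : c != 0 by apply: contra_eqN rkg => /eqP c0; rewrite e c0 mul0mx mxrank0.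
  have nzr : r != 0 by apply: contra_eqN rkg => /eqP r0; rewrite e r0 mulmx0 mxrank0.
  split=> //; last by apply/in_HP; exists g; rewrite // -e addrC subrK.
  by have [k] := p_elt_nilpotent p_pr pg; rewrite e => /nilpotent_rank1; apply.
pose T := [set g in H | p.-elt g & \rank (GLval g - 1) == 1%N].
(* [U] is spanned by the centres. It is [H]-invariant and nonzero, hence the whole space, so no
   proper subspace contains all centres. *)
pose U := (\sum_(g in T) (GLval g - 1))%MS.
have subT g : g \in T -> (GLval g - 1 <= U)%MS by move=> Tg; exact: (sumsmx_sup g).
have fullU : row_full U.
  apply: irrH.
    move=> g Hg; apply: submx_trans (_ : (\sum_(h in T) ((GLval h - 1) *m GLval g) <= U)%MS).
      by rewrite sumsmxMr.
    apply/sumsmx_subP => h; rewrite inE => /and3P[Hh ph /eqP rkh].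
    have conj1 : (GLval h - 1) *m GLval g = GLval g *m (GLval (h ^ g)%g - 1).
      rewrite mulmxBl mulmxBr mulmx1 mul1mx conjgE -GL_MxE; congr (_ - _).
      by rewrite -[RHS]/(GLval (g * (g^-1 * (h * g)))%g) mulKVg.
    have ug : GLval g \in unitmx by exact: GL_unitmx.
    have rkE : \rank (GLval (h ^ g)%g - 1) = \rank (GLval h - 1).
      rewrite -(mxrankMfree (GLval h - 1) (_ : row_free (GLval g))) ?row_free_unit //.
      by rewrite conj1 (eqmxMfull _ (_ : row_full (GLval g))) ?row_full_unit.
    rewrite conj1; apply: submx_trans (submxMl _ _) (subT _ _).
    by rewrite inE groupJ // p_eltJ ph; apply/eqP; exact: etrans rkE rkh.
  apply/negP => /eqP U0; have Tt : t \in T by rewrite inE Ht pt rkt eqxx.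
  have := subT t Tt; rewrite U0 submx0 => /eqP t0.
  by move: rkt; rewrite t0 mxrank0.
have outside m (W : 'M_(m, 3)) : (\rank W < 3)%N ->
    exists c r, [/\ r *m c = 0, c != 0, r != 0, in_H c r & ~~ (r <= W)%MS].
  move=> ltW; have [g Tg nsg] : exists2 g, g \in T & ~~ (GLval g - 1 <= W)%MS.
    apply/exists_inP; apply: contraLR ltW; rewrite negb_exists_in -leqNgt => /forall_inP sTW.
    have /mxrankS : (U <= W)%MS.
      by apply/sumsmx_subP => g Tg; have := sTW g Tg; rewrite negbK.
    by move/eqP: fullU => ->.
  have := Tg; rewrite inE => /and3P[Hg pg /eqP rkg].
  have [c [r [e rc nzc nzr Hcr]]] := trP g Hg pg rkg; exists c, r; split=> //.
  by apply: contra nsg; rewrite e; apply: submx_trans; exact: submxMl.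
have rk2 r1 r2 : r1 != 0 -> ~~ (r2 <= r1)%MS -> \rank (col_mx r1 r2) = 2%N.
  move=> nz1 ns; apply/eqP; rewrite eqn_leq rank_leq_row -addsmxE /=.
  have rk1 : \rank r1 = 1%N by apply/eqP; rewrite rank_rV nz1.
  rewrite -{1}rk1 ltn_neqAle (mxrank_leqif_sup (addsmxSl r1 r2)) addsmx_sub submx_refl /= ns.
  by rewrite mxrankS ?addsmxSl.
have [c1 [r1 [_ r1c1 nzc1 nzr1 H1]]] := trP t Ht pt rkt.
have rk1 : \rank r1 = 1%N by apply/eqP; rewrite rank_rV nzr1.
have [c2 [r2 [r2c2 nzc2 nzr2 H2 ns21]]] := outside _ r1 (leq_ltn_trans (rank_leq_row r1) (isT
  : 1 < 3)%N).
have rk12 := rk2 _ _ nzr1 ns21.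
have nz21 : r2 *m c1 != 0.
  apply/negP => /eqP r2c1; apply: (no_orthogonal_pair r2c2 r1c1 nzc2 nzc1 H2 H1 r2c1).
  by rewrite -addsmxE addsmxC addsmxE.
have [c3 [r3 [r3c3 nzc3 nzr3 H3 ns3]]] := outside _ (col_mx r1 r2) (leq_ltn_trans
  (rank_leq_row _) (isT : 2 < 3)%N).
have ns3' w : (w <= col_mx r1 r2)%MS -> ~~ (r3 <= w)%MS.
  by move=> sw; apply: contra ns3 => s3; exact: submx_trans sw.
have s1 : (r1 <= col_mx r1 r2)%MS by rewrite -addsmxE addsmxSl.
have s2 : (r2 <= col_mx r1 r2)%MS by rewrite -addsmxE addsmxSr.
have [r1c3|nz13] := eqVneq (r1 *m c3) 0.
  by apply: (no_orthogonal_pair r1c1 r3c3 nzc1 nzc3 H1 H3 r1c3); rewrite rk2 ?ns3'.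
have r2c1E := mx11_scalar (r2 *m c1); have r1c3E := mx11_scalar (r1 *m c3).
have r2c3E := mx11_scalar (r2 *m c3).
set x := _ 0 0 in r2c1E; set y := _ 0 0 in r1c3E; set z := _ 0 0 in r2c3E.
have nzx : x != 0 by apply: contraNneq nz21 => x0; rewrite r2c1E x0 raddf0.
have nzy : y != 0 by apply: contraNneq nz13 => y0; rewrite r1c3E y0 raddf0.
(* The combination of [r1] and [r2] killed by [c3]. The further division by [x = r2 *m c1] below
   yields a transvection sending [r2] to [w]. *)
pose w := r2 + (- (z / y)) *: r1.
have wc3 : w *m c3 = 0.
  by rewrite mulmxDl -scalemxAl r1c3E r2c3E -mul_scalar_mx -scalar_mxM mulNr divfK // -raddfD
    subrr raddf0.
have sw : (w <= col_mx r1 r2)%MS by rewrite addmx_sub ?scalemx_sub.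
have nzw : w != 0.
  apply: contraNneq ns21 => w0; have -> : r2 = (z / y) *: r1; last by rewrite scalemx_sub.
  by apply/eqP; rewrite -subr_eq0 -scaleNr -/w w0.
have /in_HP[g Hg eg] : in_H c1 ((- (z / y) / x) *: r1) by apply: in_HZ.
have wE : r2 *m GLval g = w.
  by rewrite eg mulmxDr mulmx1 mulmxA r2c1E mul_scalar_mx scalerA mulrC divfK.
have := in_H_conj Hg H2; rewrite wE => Hw.
apply: (no_orthogonal_pair _ r3c3 _ nzc3 Hw H3 wc3); last by rewrite rk2 ?ns3'.
  by rewrite -wE -mulmxA (mulmxA (GLval g)) GLmulgV mul1mx.
apply: contraNneq nzc2 => e; rewrite -[c2]mul1mx -(GLmulgV g) -mulmxA e mulmx0 //.
Qed.

End Transvections.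

(** * Faithful modules of order at most p^3 *)

Lemma injm_strongly_embedded (aT rT : finGroupType) (p : nat) (D H M : {group aT})
    (f : {morphism D >-> rT}) :
  'injm f -> H \subset D -> strongly_p_embedded p H M ->
  strongly_p_embedded p (f @* H) (f @* M).
Proof.
move=> injf sHD [/andP[sMH nsHM] pM se]; have sMD := subset_trans sMH sHD.
split; first by rewrite properE morphimS //= morphimSGK // (subset_trans _ (sub1G M)).
  by rewrite card_injm.
move=> _ /setDP[/morphimP[g Dg Hg ->] Mg]; rewrite -morphimJ // -injmI // ?conj_subG //.
rewrite card_injm ?se // ?inE ?Hg ?andbT; last by rewrite subIset ?sMD.
by apply: contra Mg; exact: mem_morphim.
Qed.

Section FaithfulModules.
Variables (gT : finGroupType) (p : nat) (V H : {group gT}).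
Hypotheses (p_pr : prime p) (abV : p.-abelem V) (nVH : H \subset 'N(V)) (cHV : 'C_H(V) = 1).
Implicit Types P U : {group gT}.

(** Translation of the action on [V] into matrices: irreducibility and orders of centralizers become
    statements on subspaces and ranks. *)
Lemma faithful_linear_morphism n : #|V| = (p ^ n.+1)%N ->
  exists f : {morphism H >-> {'GL_n.+1['F_p]}},
    [/\ 'injm f,
        minnormal V H -> forall U : 'M['F_p]_n.+1,
          {in H, forall g, ((U *m GLval (f g))%R <= U)%MS} -> U != 0%R -> row_full U
      & {in H, forall x, #|'C_V[x]| = (p ^ (n.+1 - \rank (GLval (f x) - 1)%R))%N}].
Proof.
move=> oV; have ntV : V :!=: 1 by rewrite -cardG_gt1 oV -{1}(expn0 p) ltn_exp2l ?prime_gt1.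
have : abelem_dim' V = n.
  by apply: succn_inj; rewrite (dim_abelemE abV ntV) oV pfactorK.
move=> <-; pose rG := abelem_repr abV ntV nVH.
exists (reprGL_morphism rG); split.
- by rewrite ker_reprGLm rker_abelem cHV.
- move/(abelem_mx_irrP abV ntV nVH) => [_ _ irr] U stU ntU.
  rewrite -sub1mx; apply: irr ntU; rewrite ?submx1 //.
  apply/mxmoduleP => x Hx; rewrite -(val_reprGLm rG Hx); exact: stU.
move=> x Hx; have ef : GLval (reprGL_morphism rG x) = rG x := val_reprGLm rG Hx.
rewrite [X in (_ - \rank (X - 1)%R)%N]ef.
have sxH : [set x] \subset H by rewrite sub1set.
have eqk : (rfix_mx rG [set x] :=: kermx (rG x - 1)%R)%MS.
  apply/eqmxP/andP; split.
    have /rfix_mxP fx := submx_refl (rfix_mx rG [set x]).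
    by apply/sub_kermxP; rewrite mulmxBr mulmx1 fx ?set11 // GRing.subrr.
  apply/rfix_mxP => _ /set1P->; have /eqP := mulmx_ker (rG x - 1)%R.
  by rewrite mulmxBr mulmx1 GRing.subr_eq0 => /eqP.
rewrite -mxrank_ker -eqk (rfix_abelem abV ntV nVH sxH).
have := card_rowg (rowg_mx (abelem_rV abV ntV @* 'C_V([set x]))).
rewrite -cent_set1 rowg_mxK card_Fp // => <-.
by rewrite card_injm ?abelem_rV_injm ?subsetIl.
Qed.

End FaithfulModules.

(** * Irreducible modules of order p^3 *)

Section IrreducibleRank3.
Variables (gT : finGroupType) (p : nat) (V H M : {group gT}).
Hypotheses (p_pr : prime p) (abV : p.-abelem V) (nVH : H \subset 'N(V)) (cHV : 'C_H(V) = 1).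
Hypotheses (seM : strongly_p_embedded p H M) (oV : #|V| = (p ^ 3)%N) (irrV : minnormal V H).
Implicit Types P U : {group gT}.

(** The rank of [x - 1] is 2: it is not 0 by faithfulness, not 1 since there are no transvections,
    and not 3 since [x] fixes a nonzero vector. *)
Lemma irreducible_cent1_card x : x \in H -> p.-elt x -> x != 1 -> #|'C_V[x]| = p.
Proof.
move=> Hx px ntx.
have [f [injf irrf rkf]] := faithful_linear_morphism p_pr abV nVH cHV oV.
have irr_fH (U : 'M['F_p]_3) : {in f @* H, forall g : {'GL_3['F_p]}, ((U *m GLval g)%R <=
  U)%MS} -> U != 0%R -> row_full U.
  by move=> stU; apply: irrf => // g Hg; apply: stU; rewrite mem_morphim.
have seM' : strongly_p_embedded p (f @* H) (f @* M) by exact: injm_strongly_embedded.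
have fx : f x \in f @* H by rewrite mem_morphim.
have pfx : p.-elt (f x) by rewrite morph_p_elt.
have ntfx : f x != 1 by rewrite (morph_injm_eq1 injf).
rewrite (rkf x Hx); set k := \rank _.
have : k != 1%N.
  by apply/negP => /eqP; exact: (irreducible_no_transvection p_pr seM' irr_fH fx pfx).
have : k != 0%N.
  apply: contra ntfx; rewrite mxrank_eq0 GRing.subr_eq0 => /eqP e1.
  by apply/eqP/val_inj.
have : k < 3.
  have [v nzv fv] := p_elt_fixes p_pr pfx.
  rewrite ltn_neqAle rank_leq_row andbT; apply/negP => /eqP k3.
  have rf : row_free (GLval (f x) - 1)%R by rewrite /row_free -/k k3.
  case/eqP: nzv; apply: (row_free_inj rf).
  by rewrite mul0mx mulmxBr mulmx1 fv GRing.subrr.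
by case: k => [|[|[|//]]]; rewrite ?expn1.
Qed.

(** Counting orbits on [V], [#|P|] divides [p ^ 3 + (#|P| - 1) * p]. If [p ^ 2] divided [#|P|], then
    [p] would divide both [#|P|] and [#|P| - 1]. *)
Lemma irreducible_psubgroup_card P : P \subset H -> p.-group P -> #|P| %| p.
Proof.
move=> sPH pP; have nVP := subset_trans sPH nVH.
have [le1|le1] := leqP (logn p #|P|) 1.
  by rewrite (card_pgroup pP) -[X in _ %| X]expn1 dvdn_exp2l.
have actV : [acts P, on V | 'J] by rewrite astabsJ.
have := Frobenius_Cauchy actV.
rewrite (bigD1 1) //= => eF.
have : (p ^ 2 %| p ^ 3 + #|P|.-1 * p)%N.
  apply: dvdn_trans (_ : #|P| %| _); first by rewrite (card_pgroup pP) dvdn_exp2l.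
  rewrite (_ : (_ + _)%N = (#|orbit 'J P @: V| * #|P|)%N) ?dvdn_mull // -eF; congr (_ + _)%N.
    by rewrite afix1 setIT oV.
  rewrite (cardD1 1) group1 /= -sum_nat_const; apply: eq_big => [x|x].
    by rewrite !inE andbC.
  rewrite !inE => /andP[ntx Px]; rewrite afixJ cent_set1 irreducible_cent1_card //.
    exact: (subsetP sPH).
  exact: mem_p_elt pP Px.
rewrite dvdn_addr ?dvdn_exp2l // expnSr expn1 dvdn_pmul2r ?prime_gt0 //.
move=> dvd1; have : p %| #|P| by rewrite (card_pgroup pP) (dvdn_exp2l _ (ltnW le1)).
rewrite -(prednK (cardG_gt0 P)) -addn1 dvdn_addr // dvdn1 => /eqP p1.
by have := prime_gt1 p_pr; rewrite p1.
Qed.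

(** The endomorphism sending [v] to [[~ v, x]] has kernel of order [p], hence image of order
    [p ^ 2], too large to lie in ['C_V[x]]. *)
Lemma irreducible_nonquadratic x :
  x \in H -> p.-elt x -> x != 1 -> exists2 v, v \in V & [~ v, x, x] != 1.
Proof.
move=> Hx px ntx; have oC := irreducible_cent1_card Hx px ntx.
apply/exists_inP; apply: contraT; rewrite negb_exists_in => /forall_inP quad.
have nVx : x \in 'N(V) := subsetP nVH x Hx.
have cVV := abelem_abelian abV.
pose f v := [~ v, x].
have Vf v : v \in V -> f v \in V by move=> Vv; rewrite /f commgEl groupM ?groupV ?memJ_norm.
have fM : {in V &, {morph f : v w / v * w}}.
  move=> v w Vv Vw; rewrite /f commMgJ; congr (_ * _).
  by rewrite conjgE (centsP cVV _ (Vf v Vv) _ Vw) mulKg.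
pose phi := Morphism fM.
have kphi : 'ker phi = 'C_V[x].
  apply/setP=> v; apply/idP/setIP => [kv | [Vv /cent1P/commgP/eqP fv]]; last exact/kerP.
  by split; [exact: dom_ker kv | apply/cent1P/commgP/eqP; exact: mker kv].
have := card_morphim phi V; rewrite setIid kphi => oim.
have sim : phi @* V \subset 'C_V[x].
  apply/subsetP => _ /morphimP[v _ Vv ->]; apply/setIP; split; first exact: Vf.
  apply/cent1P/commgP.
  by have := quad v Vv; rewrite negbK.
have := subset_leq_card sim; rewrite oim.
rewrite -(leq_pmul2l (cardG_gt0 'C_V[x])) Lagrange ?subsetIl // oV oC.
by rewrite mulnn leq_exp2l ?prime_gt1.
Qed.

End IrreducibleRank3.

Lemma injm_Opprime (aT rT : finGroupType) (p : nat) (D H : {group aT}) (f : {morphism D >-> rT}) :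
  'injm f -> H \subset D -> f @* Opprime p H = Opprime p (f @* H).
Proof.
move=> injf sHD; have sD : [set x in H | p.-elt x] \subset D.
  by apply/subsetP=> x; rewrite inE => /andP[/(subsetP sHD)].
rewrite /Opprime morphim_gen //; congr <<_>>; apply/setP=> y; rewrite inE.
apply/morphimP/andP => [[x Dx] | [/morphimP[x Dx Hx ->]]].
  by rewrite inE => /andP[Hx px] ->; rewrite mem_morphim // morph_p_elt.
by rewrite /p_elt order_injm // => px; exists x; rewrite ?inE ?Hx.
Qed.

Lemma Opprime_char (gT : finGroupType) (p : nat) (H : {group gT}) : Opprime p H \char H.
Proof.
apply/charP; split=> [|f injf fH].
  by rewrite gen_subG; apply/subsetP=> x; rewrite inE => /andP[].
by rewrite (injm_Opprime p injf) // fH.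
Qed.

Lemma Opprime_id (gT : finGroupType) (p : nat) (H : {group gT}) :
  Opprime p <<[set x in H | p.-elt x]>>%G = Opprime p H.
Proof.
congr <<_>>; apply/setP=> x; rewrite !inE; apply: andb_id2r => px; apply/idP/idP.
  by apply/subsetP; rewrite (char_sub (Opprime_char p H)).
by move=> Hx; rewrite mem_gen // inE Hx.
Qed.

Lemma faithful_rank2_SL2 (gT : finGroupType) (p : nat) (V H : {group gT}) :
  prime p -> p.-abelem V -> H \subset 'N(V) -> 'C_H(V) = 1 -> #|V| = (p ^ 2)%N ->
  Opprime p H = H -> ~~ p.-group H -> H \isog SL2 p.
Proof.
move=> p_pr abV nVH cHV oV OH npH.
have [f [injf _ _]] := faithful_linear_morphism p_pr abV nVH cHV oV.
have <- : f @* H = SL2 p.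
  apply: (Opprime_GL2 p_pr); first by rewrite -(injm_Opprime p injf) // OH.
  by rewrite injm_pgroup.
exact: sub_isog.
Qed.

Lemma p_elt_comm_index (gT : finGroupType) (p : nat) (A B : {group gT}) x :
  prime p -> p.-group A -> p.-elt x -> x \in 'N(A) -> x \in 'N(B) -> B \subset A ->
    A \subset 'N(B) ->
  #|A : B| %| p -> [~: A, <[x]>] \subset B.
Proof.
move=> p_pr pA px nAx nBx sBA nBA /(prime_nt_dvdP p_pr) iAB.
have nAX : <[x]> \subset 'N(A) by rewrite cycle_subG.
have [/eqP|] := eqVneq #|A : B| 1%N; last move/iAB=> {}iAB.
  by rewrite indexg_eq1 => sAB; apply: subset_trans sAB; rewrite commg_subl.
pose S := (A <*> <[x]>)%G.
have pS : p.-group S by rewrite /S /= norm_joinEr // pgroupM pA.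
have nAS : S \subset 'N(A) by rewrite join_subG normG.
have nBS : S \subset 'N(B) by rewrite join_subG nBA cycle_subG.
apply: subset_trans (comm_normal_index_p p_pr pS (joing_subl _ _) nAS nBS sBA iAB).
exact/commgS/joing_subr.
Qed.

(** * Reducible or smaller modules *)

Section ReducibleRank3.
Variables (gT : finGroupType) (p : nat) (V H M : {group gT}).
Hypotheses (p_pr : prime p) (abV : p.-abelem V) (nVH : H \subset 'N(V)) (cHV : 'C_H(V) = 1).
Hypothesis (seM : strongly_p_embedded p H M).

(** The group [K] generated by the [p]-elements centralizes [V0] and [V / V1], whose orders divide
    [p]. So the kernel of [K] on [V1 / V0] is a normal [p]-subgroup, hence trivial, and the rank 2
    case applies to [V1 / V0]. *)
Lemma Opprime_section_SL2 (V0 V1 : {group gT}) :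
  V0 \subset V1 -> V1 \subset V -> H \subset 'N(V0) -> H \subset 'N(V1) ->
  #|V0| %| p -> #|V : V1| %| p -> #|V1 : V0| %| p ^ 2 -> Opprime p H \isog SL2 p.
Proof.
move=> sV01 sV1 nV0H nV1H oV0 iV1 iV01.
have pV := abelem_pgroup abV; have cVV := abelem_abelian abV.
have sV0 := subset_trans sV01 sV1.
pose K := <<[set x in H | p.-elt x]>>%G; rewrite -[Opprime p H]/(gval K).
have nsK : K <| H := char_normal (Opprime_char p H).
have sKH := normal_sub nsK.
have nV0V : V \subset 'N(V0) := sub_abelian_norm cVV sV0.
have nV1V : V \subset 'N(V1) := sub_abelian_norm cVV sV1.
have Kcent (A B : {group gT}) : A \subset V -> B \subset A -> H \subset 'N(A) -> H \subset 'N(B) ->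
    #|A : B| %| p -> [~: A, K] \subset B.
  move=> sAV sBA nAH nBH iAB.
  have nBA : A \subset 'N(B) := sub_abelian_norm (abelianS sAV cVV) sBA.
  rewrite -quotient_cents2 ?(subset_trans sKH) // centsC.
  rewrite quotient_gen; last by apply/subsetP=> x; rewrite inE => /andP[Hx _]; exact: (subsetP nBH).
  rewrite gen_subG; apply/subsetP => _ /morphimP[x Nx /setIdP[Hx px] ->].
  have : <[x]> / B \subset 'C(A / B).
    rewrite centsC quotient_cents2 ?cycle_subG //.
    apply: p_elt_comm_index px _ _ _ _ iAB => //; first exact: pgroupS sAV pV.
    exact: (subsetP nAH).
  by move/subsetP; apply; apply: mem_quotient; exact: cycle_id.
(* [V] and [H] lie in one group, so the action on [V1 / V0] is read in the quotient by [V0]; this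
   must be injective on [H]. *)
have tiHV0 : V0 :&: H = 1.
  apply/trivgP; rewrite -cHV subsetI subsetIr centsC.
  by apply: subset_trans (centS (subset_trans (subsetIl _ _) sV0)).
have isoH := quotient_isom nV0H tiHV0.
pose f := restrm nV0H (coset V0).
have injf : 'injm f by case/isomP: isoH.
have fE (A : {group gT}) : A \subset H -> f @* A = A / V0 by move=> sAH; rewrite restrmEsub.
have npK : ~~ p.-group K.
  apply/negP => pK; have sK := pcore_max pK nsK.
  rewrite (strongly_embedded_core p_pr seM) in sK.
  have [/andP[sMH _] pM _] := seM; have [x Mx ox] := Cauchy p_pr pM.
  have Kx : x \in K.
    by rewrite mem_gen // inE (subsetP sMH) // /p_elt ox pnat_id.
  by have := subsetP sK x Kx; rewrite inE => /eqP x1; move: (prime_gt1 p_pr); rewrite -ox x1 order1.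
have sKV0 : K / V0 \subset H / V0 := quotientS _ sKH.
have cW : 'C_(K / V0)(V1 / V0) = 1.
  have seV0 : strongly_p_embedded p (H / V0) (M / V0).
    have [/andP[sMH _] _ _] := seM.
    by rewrite -(fE H) // -(fE M) //; apply: injm_strongly_embedded.
  apply/trivgP; rewrite -(strongly_embedded_core p_pr seV0).
  apply: (pcore_max (H := [group of 'C_(K / V0)(V1 / V0)])); last first.
    rewrite /normal subIset ?sKV0 // normsI ?norms_cent ?quotient_norms //.
    exact: normal_norm nsK.
  apply/pgroupP => q q_pr /(Cauchy q_pr)[yb /setIP[/morphimP[y Ny Ky ->] cy] oy].
  have Hy := subsetP sKH y Ky.
  have {}oy : #[y] = q by rewrite -oy; apply/esym/(order_injm injf Hy).
  rewrite inE /=; apply: contraT => neqp.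
  have coy : coprime #|V| #|<[y]>|.
    by rewrite (pnat_coprime pV) // [#|_|]oy p'natE // dvdn_prime2 // eq_sym.
  have nVy : <[y]> \subset 'N(V) by rewrite cycle_subG (subsetP nVH).
  have syK : <[y]> \subset K by rewrite cycle_subG.
  have c1 : [~: V, <[y]>] \subset V1 := subset_trans (commgS _ syK) (Kcent V V1 (subxx _) sV1
    nVH nV1H iV1).
  have c3 : [~: V0, <[y]>] \subset [1].
    apply: subset_trans (commgS _ syK) (Kcent V0 1%G sV0 (sub1G _) nV0H _ _); rewrite ?norms1 //.
    by rewrite indexg1.
  have c2 : [~: V1, <[y]>] \subset V0.
    rewrite -quotient_cents2 ?cycle_subG ?(subset_trans sV1) // centsC.
    by rewrite quotient_cycle // cycle_subG.
  (* A [p']-element [y] of the kernel acts trivially on all three factors of the series. As [[~: V,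
     <[y]>]] meets the centralizer of [y] in [V] trivially, this first kills [[~: V, <[y]>, <[y]>]],
     then [[~: V, <[y]>]]. *)
  have tiC := coprime_abel_cent_TI nVy coy cVV.
  have sVyy : [~: V, <[y]>, <[y]>] \subset [~: V, <[y]>] by rewrite commg_subl commg_normr.
  have cyy : [~: V, <[y]>, <[y]>] \subset [1].
    rewrite -tiC subsetI sVyy; apply/commG1P/trivgP; apply: subset_trans c3.
    apply: commSg; apply: subset_trans c2; exact: commSg.
  have c0 : [~: V, <[y]>] \subset [1].
    by rewrite -tiC subsetI subxx; apply/commG1P/trivgP.
  have : y \in 'C_H(V).
    by rewrite inE Hy -cycle_subG centsC; apply/commG1P/trivgP.
  rewrite cHV => /set1P y1; have := prime_gt1 q_pr; by rewrite -oy y1 order1.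
have iW : #|V1 / V0| = (p ^ 2)%N.
  have nV0V1 := subset_trans sV1 nV0V.
  have not_p : ~~ (#|V1 : V0| %| p).
    apply: contra npK => iVp; have cV10 := Kcent V1 V0 sV1 sV01 nV1H nV0H iVp.
    have K1 : K / V0 = 1.
      rewrite -cW; apply/esym/setIidPl; rewrite centsC quotient_cents2 //.
      exact: subset_trans sKH nV0H.
    by rewrite -(injm_pgroup injf) // fE // K1 pgroup1.
  rewrite card_quotient //; have /(dvdn_pfactor _ _ p_pr)[k lek oW] := iV01; rewrite oW.
  move: not_p; rewrite oW; case: k lek {oW} => [|[|[|//]]] _ //.
    by rewrite expn0 dvd1n.
  by rewrite expn1 dvdnn.
have OKV : Opprime p (K / V0) = K / V0.
  by rewrite -fE // -(injm_Opprime p injf) // Opprime_id.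
have isoK : K \isog K / V0 by rewrite -fE // sub_isog.
have isoSL : K / V0 \isog Group (SL2_group_set p).
  apply: (faithful_rank2_SL2 (V := (V1 / V0)%G)) => //=.
  - exact: quotient_abelem (abelemS sV1 abV).
  - by rewrite quotient_norms // (subset_trans sKH).
  - by rewrite -fE // injm_pgroup.
exact: isog_trans isoK isoSL.
Qed.

(** In the reducible case a minimal invariant [U] has order [p] or [p ^ 2], and the section of order
    [p ^ 2] is [V / U] or [U]. *)
Lemma strongly_embedded_rank3 :
  #|V| %| p ^ 3 -> Opprime p H \isog SL2 p \/ #|V| = (p ^ 3)%N /\ minnormal V H.
Proof.
move=> leV; have pV := abelem_pgroup abV.
have [irr | nirr] := boolP ((#|V| == (p ^ 3)%N) && minnormal V H).
  by right; case/andP: irr => /eqP.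
left; have [k lek oV] : exists2 k, k <= 3 & #|V| = (p ^ k)%N by apply/(dvdn_pfactor _ _ p_pr).
have p_gt1 := prime_gt1 p_pr.
have [k3 | ltk] := eqVneq k 3; last first.
  apply: (Opprime_section_SL2 (sub1G V)); rewrite ?norms1 ?cards1 ?dvd1n ?indexgg ?indexg1 //.
  by rewrite oV dvdn_exp2l // -ltnS ltn_neqAle ltk.
have ntV : V :!=: 1 by rewrite -cardG_gt1 oV k3 -{1}(expn0 p) ltn_exp2l.
have [U minU sUV] := minnormal_exists ntV nVH.
have [/andP[ntU nUH] _] := mingroupP minU.
have [j lej oU] : exists2 j, j <= 3 & #|U| = (p ^ j)%N.
  by apply/(dvdn_pfactor _ _ p_pr); rewrite -k3 -oV cardSg.
have iU : #|V : U| = (p ^ (3 - j))%N.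
  by rewrite -divgS // oV oU k3 expnB ?prime_gt0.
have := nirr; rewrite oV k3 eqxx /= => nirrV.
case: j lej oU iU => [|[|[|[|//]]]] _ oU iU.
- by case/negP: ntU; rewrite trivg_card1 oU.
- apply: (Opprime_section_SL2 sUV (subxx V)) => //; first by rewrite oU expn1.
    by rewrite indexgg.
  by rewrite iU.
- apply: (Opprime_section_SL2 (sub1G U) sUV) => //; rewrite ?norms1 ?cards1 ?iU ?expn1 //.
  by rewrite indexg1 oU.
- have eUV : U :=: V by apply/eqP; rewrite eqEcard sUV oU oV k3 /=.
  by case/negP: nirrV; rewrite -eUV.
Qed.

End ReducibleRank3.

(** * Automorphism groups of essential subgroups *)

(* [yT] is a quotient of the holomorph of [E] by ['Phi(E) C_L(E / 'Phi(E))]. *)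
Lemma aut_module (gT : finGroupType) (p : nat) (E : {group gT}) (L : {group {perm gT}}) :
    prime p -> p.-group E -> L \subset Aut E ->
  exists (yT : finGroupType) (h : {morphism E >-> yT}) (f : {morphism L >-> yT}),
    [/\ 'ker h = 'Phi(E), p.-group ('ker f),
        {in L & E, forall (a : {perm gT}) e, h (a e) = h e ^ f a}
      & 'C_(f @* L)(h @* E) = 1].
Proof.
move=> p_pr pE sLE.
pose to := aut_groupAction E.
pose i1 := sdpair1_morphism to; pose i2 := sdpair2_morphism to.
have inj1 : 'injm i1 := injm_sdpair1 to.
have inj2 : 'injm i2 := injm_sdpair2 to.
pose E' := (i1 @* E)%G; pose L' := (i2 @* L)%G.
have pE' : p.-group E' by rewrite morphim_pgroup.
have tiEL : E' :&: L' = 1.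
  by apply/trivgP; rewrite -(im_sdpair_TI to) setIS // morphimS.
have nEL : L' \subset 'N(E').
  exact: subset_trans (morphimS _ sLE) (im_sdpair_norm to).
have act12 : {in L & E, forall (a : {perm gT}) e, i1 (a e) = i1 e ^ i2 a}.
  by move=> a e La Ee; rewrite -(sdpair_act to) ?(subsetP sLE).
pose F := 'Phi(E')%G; have nFE : E' \subset 'N(F) by rewrite gFnorm.
have nFL : L' \subset 'N(F) := gFnorm_trans _ nEL.
pose C := (L' :&: coset F @*^-1 'C(E' / F))%G.
have sCL : C \subset L' := subsetIl _ _.
have cC : [~: E', C] \subset F.
  rewrite -quotient_cents2 ?(subset_trans sCL) // centsC.
  apply: subset_trans (quotientS _ (subsetIr _ _)) _.
  by rewrite cosetpreK.
have inC y : y \in L' -> [~: E', <[y]>] \subset F -> y \in C.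
  move=> Ly cy; have Ny := subsetP nFL y Ly.
  rewrite inE Ly mem_morphpre //; apply: (subsetP _ _ (mem_quotient F (cycle_id y))).
  by rewrite centsC quotient_cents2 ?cycle_subG.
have faithL y : y \in L' -> E' \subset 'C[y] -> y = 1.
  case/morphimP=> a Aa La -> /subsetP cE; suff -> : a = 1 by rewrite morph1.
  apply: (eq_Aut Aa (group1 _)) => e Ee; rewrite perm1.
  apply: (injmP inj1) => //; first by rewrite Aut_closed.
  rewrite act12 //; apply/conjg_fixP/commgP/cent1P; apply: cE; exact: mem_morphim.
(* Coprime action: a [p']-element centralizing the Frattini quotient of [E'] centralizes [E']. *)
have pC : p.-group C.
  apply/pgroupP => q q_pr /(Cauchy q_pr)[y Cy oy].
  have Ly := subsetP sCL y Cy; rewrite inE /=; apply: contraT => neqp.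
  have syC : <[y]> \subset C by rewrite cycle_subG.
  have coy : coprime #|E'| #|<[y]>|.
    by rewrite (pnat_coprime pE') // [#|_|]oy p'natE // dvdn_prime2 // eq_sym.
  have nFy : <[y]> \subset 'N(F) := subset_trans syC (subset_trans sCL nFL).
  have defC := coprime_quotient_cent (Phi_sub E') nFy coy (pgroup_sol pE').
  have cEy : 'C_E'(<[y]>) = E'.
    have sCE : 'C_E'(<[y]>) \subset E' := subsetIl _ _.
    rewrite -[LHS]genGid; apply: Phi_nongen; apply/eqP; rewrite eqEsubset join_subG Phi_sub sCE /=.
    rewrite norm_joinEr ?(subset_trans sCE) // -quotientSK // defC subsetI subxx /=.
    by rewrite quotient_cents2 // (subset_trans (commgS _ syC)).
  have y1 : y = 1.
    by apply: faithL => //; rewrite -cEy cent_cycle subsetIr.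
  by have := prime_gt1 q_pr; rewrite -oy y1 order1.
(* [N] meets [E'] in [F] and [L'] in [C], so the quotient by [N] contains [E' / F] together with the
   faithful image of [L'] acting on it. *)
pose N := (F <*> C)%G.
have nFC : C \subset 'N(F) := subset_trans sCL nFL.
have nsC : C <| L'.
  rewrite /normal sCL normsI ?normG //.
  apply: subset_trans (_ : coset F @*^-1 (L' / F) \subset _).
    by rewrite quotientK // mulG_subr.
  by rewrite morphpre_norms // norms_cent // quotient_norms.
have nNL : L' \subset 'N(N) by rewrite normsY // normal_norm.
have nNE : E' \subset 'N(N).
  apply/subsetP => x Ex; rewrite inE -genJ gen_subG conjUg subUset.
  rewrite (normP (subsetP nFE x Ex)) joing_subl /=.
  apply/subsetP => _ /imsetP[c Cc ->]; rewrite conjg_mulR.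
  have Ncx : [~ c, x] \in N.
    apply: (subsetP (joing_subl F C)); apply: (subsetP cC).
    by rewrite commGC mem_commg.
  by rewrite groupM // (subsetP (joing_subr F C)).
have sFE : F \subset E' := Phi_sub E'.
have NE : N :&: E' = F.
  rewrite /N /= norm_joinEr // -group_modl //.
  suff -> : C :&: E' = 1 by rewrite mulg1.
  by apply/trivgP; apply: subset_trans (setSI _ sCL) _; rewrite setIC tiEL.
have NL : N :&: L' = C.
  rewrite /N /= norm_joinEr // setIC -group_modr //.
  suff -> : L' :&: F = 1 by rewrite mul1g.
  by apply/trivgP; apply: subset_trans (setIS _ sFE) _; rewrite setIC tiEL.
have sE : E \subset i1 @*^-1 'N(N) by rewrite -sub_morphim_pre.
have sL : L \subset i2 @*^-1 'N(N) by rewrite -sub_morphim_pre.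
have defF : F = i1 @* 'Phi(E) :> {set _} by rewrite injm_Phi.
pose h := restrm_morphism sE (comp_morphism i1 (coset_morphism N)).
pose f := restrm_morphism sL (comp_morphism i2 (coset_morphism N)).
have hE e : h e = coset N (i1 e) by [].
have fE a : f a = coset N (i2 a) by [].
have E'i e : e \in E -> i1 e \in E' by move=> Ee; exact: mem_morphim.
have L'i a : a \in L -> i2 a \in L' by move=> La; apply: mem_morphim => //; exact: (subsetP sLE).
have Ni1 e : e \in E -> i1 e \in 'N(N) by move=> Ee; apply: (subsetP nNE); exact: E'i.
have Ni2 a : a \in L -> i2 a \in 'N(N) by move=> La; apply: (subsetP nNL); exact: L'i.
exists (coset_of N), h, f; split.
- apply/setP => e; apply/idP/idP => [ke | Pe].
    have Ee : e \in E by exact: dom_ker ke.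
    have /coset_idr Ne : coset N (i1 e) = 1 by exact: mker ke.
    have : i1 e \in F by rewrite -NE inE Ne ?Ni1 // E'i.
    rewrite defF => /morphimP[e' Ee' Pe' eqe].
    by rewrite (injmP inj1 _ _ Ee Ee' eqe).
  have Ee := subsetP (Phi_sub E) e Pe; apply/kerP => //; rewrite hE coset_id //.
  by apply: (subsetP (joing_subl F C)); rewrite defF mem_morphim.
- have skL : 'ker f \subset L := subsetIl _ _.
  rewrite -(injm_pgroup inj2) ?(subset_trans skL) //; apply: pgroupS pC.
  apply/subsetP => _ /morphimP[a _ ka ->]; have La := subsetP skL a ka.
  have /coset_idr Na : coset N (i2 a) = 1 by exact: mker ka.
  by rewrite -NL inE Na ?Ni2 // L'i.
- by move=> a e La Ee; rewrite !hE fE act12 // morphJ ?Ni1 ?Ni2.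
apply/trivgP/subsetP => _ /setIP[/morphimP[a _ La ->] ca].
have himE : h @* E = E' / N.
  by rewrite morphim_restrm setIid morphim_comp.
have cEa : [~: E', <[i2 a]>] \subset F.
  rewrite -NE subsetI commg_subl cycle_subG (subsetP nEL) ?L'i // andbT.
  rewrite -quotient_cents2 ?cycle_subG ?Ni2 // centsC -himE.
  by rewrite quotient_cycle ?Ni2 // cycle_subG.
have Ca := inC _ (L'i a La) cEa.
by rewrite inE fE coset_id // (subsetP (joing_subr F C)).
Qed.

Section Essential.
Variables (gT : finGroupType) (p : nat) (S : {group gT}) (F : fmor gT).
Hypotheses (p_pr : prime p) (pS : p.-group S) (satF : saturated p S F).
Implicit Types E T : {group gT}.

Lemma AutS_conj_aut T E : T \subset 'N(E) -> AutS T E = conj_aut E @* T.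
Proof.
move=> nET; apply/setP=> a; apply/idP/morphimP => [|[s Ns Ts ->]].
  rewrite inE => /andP[Aa /exists_inP[s /setIP[Ts Ns] /forall_inP as_]]; exists s => //.
  apply: (eq_Aut Aa); first exact: Aut_aut.
  by move=> x Ex; rewrite norm_conj_autE //; exact/eqP/as_.
rewrite inE Aut_aut; apply/exists_inP; exists s; first by rewrite inE Ts.
by apply/forall_inP => x Ex; rewrite norm_conj_autE.
Qed.

Lemma AutS_sub_AutF E : E \subset S -> AutS S E \subset AutF F E.
Proof.
have [[_ extF conjF _ _] _ _] := satF; move=> sES; apply/subsetP=> a.
rewrite inE => /andP[Aa /exists_inP[s /setIP[Ss Ns] /forall_inP as_]].
rewrite inE Aa; apply: extF (conjF E s sES Ss) _ => x Ex.
by rewrite !ffunE; apply/esym/eqP/as_.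
Qed.

Lemma AutF_group_set E : E \subset S -> group_set (AutF F E).
Proof.
have [[_ extF conjF [_ compF] _] _ _] := satF; move=> sES; apply/group_setP; split.
  apply/setIdP; split; first exact: group1.
  apply: extF (conjF E 1 sES (group1 S)) _ => x Ex.
  by rewrite !ffunE perm1 conjg1.
move=> a b /setIdP[Aa Fa] /setIdP[Ab Fb]; apply/setIdP; split; first exact: groupM.
have aE : [ffun x => a x] @: E = E.
  rewrite -[RHS](im_autm Aa) morphimEdom; apply: eq_imset => x; by rewrite ffunE.
have := compF E _ [ffun x => b x] Fa; rewrite aE => /(_ Fb).
by move/extF; apply=> x Ex; rewrite !ffunE permM.
Qed.

(** [OutF F E] acts faithfully on [E / 'Phi(E)], to which [strongly_embedded_rank3] applies. In the
    irreducible case the image of [S] has order dividing [p], and its nontrivial elements act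
    nonquadratically. *)
Lemma essential_SL2_or_jordan E :
  is_essential p S F E -> S \subset 'N(E) -> sectional_rank_le E 3 ->
  Opprime p (OutF F E) \isog SL2 p \/
  #|S : E| = p /\ jordan_irr3 p (AutF F E) S E.
Proof.
case=> sES centE fnE [M0 se0] nES rkE.
have [fusF sylF _] := satF.
have pE := pgroupS sES pS.
pose L := Group (AutF_group_set sES); pose I := (conj_aut E @* E)%G.
have sLA : L \subset Aut E by apply/subsetP => a; rewrite inE => /andP[].
have sEN : E \subset 'N(E) := normG E.
have defI : Inn E = I by rewrite /Inn AutS_conj_aut.
have defP := AutS_conj_aut nES.
move: M0 se0; rewrite /OutF defI -[AutF F E]/(gval L) => M seM.
have sPL : conj_aut E @* S \subset L by rewrite -defP AutS_sub_AutF.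
have sIP : I \subset conj_aut E @* S by rewrite morphimS.
have sIL := subset_trans sIP sPL.
have [yT [h [f [kh pkf hf cHV]]]] := aut_module p_pr pE sLA.
pose V := (h @* E)%G; pose H := (f @* L)%G.
have isoV : E / 'Phi(E) \isog V by have := first_isog h; rewrite kh.
have abV : p.-abelem V by rewrite -(isog_abelem isoV) Phi_quotient_abelem.
have nPhi : E \subset 'N('Phi(E)) by rewrite gFnorm.
have oV : #|V| = #|E : 'Phi(E)| by rewrite -(card_isog isoV) card_quotient.
have nVH : H \subset 'N(V).
  apply/subsetP => _ /morphimP[a _ La ->]; rewrite inE;
    apply/subsetP => _ /imsetP[_ /morphimP[e _ Ee ->] ->].
  rewrite -hf // mem_morphim // Aut_closed //; exact: (subsetP sLA).
have sIk : I \subset 'ker f.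
  apply/subsetP => _ /morphimP[x _ Ex ->]; have La : conj_aut E x \in L.
    by apply: (subsetP sIL); apply: mem_morphim => //; exact: (subsetP sEN).
  apply/kerP => //; suff : f (conj_aut E x) \in 'C_(f @* L)(h @* E) by rewrite cHV => /set1P.
  rewrite inE mem_morphim //=.
  apply/centP => _ /morphimP[e _ Ee ->]; apply/esym/commgP/conjg_fixP.
  rewrite -hf // conj_autE // morphJ //; apply/conjg_fixP/commgP.
  by apply: (centsP (abelem_abelian abV)); rewrite mem_morphim.
have nIL : L \subset 'N(I).
  apply/subsetP => a La; have Aa := subsetP sLA a La; rewrite inE;
    apply/subsetP => _ /imsetP[_ /morphimP[x _ Ex ->] ->].
  have Eax : a x \in E by rewrite Aut_closed.
  suff -> : conj_aut E x ^ a = conj_aut E (a x).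
    by apply: mem_morphim; rewrite ?(subsetP sEN).
  have Acx y : conj_aut E y \in Aut E by exact: Aut_aut.
  apply: (@eq_Aut _ E); rewrite ?groupJ // => y Ey.
  have Eay : a^-1 y \in E by rewrite Aut_closed ?groupV.
  rewrite conjgE !permM conj_autE // conj_autE // -(autmE Aa) morphJ //=.
  by rewrite autmE permKV.
(* Modulo inner automorphisms the kernel is a normal [p]-subgroup of a group with a strongly
   embedded subgroup, hence trivial. *)
have kf : 'ker f = I.
  apply/eqP; rewrite eqEsubset sIk andbT.
  have skL : 'ker f \subset L := subsetIl _ _.
  rewrite -quotient_sub1 ?(subset_trans skL) //.
  rewrite -(strongly_embedded_core p_pr seM); apply: pcore_max.
    exact: quotient_pgroup.
  by apply: quotient_normal; exact: ker_normal.
have [g injg img] := first_isom f; move: g injg img; rewrite kf => g injg img.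
have seH : strongly_p_embedded p H (g @* M).
  have := injm_strongly_embedded injg (subxx _) seM.
  by rewrite /= img.
have oV3 : #|V| %| p ^ 3.
  have pV := abelem_pgroup abV.
  have := abelem_quotient_card p_pr nPhi (Phi_quotient_abelem pE) (rkE _ (subxx E)).
  rewrite card_quotient // -oV (card_pgroup pV) leq_exp2l ?prime_gt1 //.
  exact: dvdn_exp2l.
have [isoSL | [o3 irrV]] := strongly_embedded_rank3 p_pr abV nVH cHV seH oV3.
  left; pose K := <<[set x in L / I | p.-elt x]>>%G.
  have sK : K \subset L / I := char_sub (Opprime_char p (L / I)).
  have isoK : K \isog g @* K by exact: sub_isog.
  have OK : g @* K = Opprime p H by rewrite (injm_Opprime p injg) // img.
  rewrite -OK in isoSL; exact: (isog_trans isoK (isoSL : _ \isog Group (SL2_group_set p))).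
right.
have sCE : 'C_S(E) \subset E.
  have [[_ extF conjF _ _] _ _] := satF.
  have := centE _ (conjF E 1 sES (group1 S)).
  suff -> : [ffun x => x ^ 1] @: E = E by [].
  by rewrite -[RHS]imset_id; apply: eq_imset => x; rewrite ffunE conjg1.
(* The kernel of the conjugation action of [S] is its centralizer of [E], contained in [E]. *)
have iSE : #|S : E| = #|conj_aut E @* S : I|.
  rewrite -(index_morphim_ker (conj_aut_morphism E) sES nES) ker_conj_aut.
  by rewrite -[X in (_ * X)%N]indexgI (setIidPl sCE) indexgg muln1.
have pP : p.-group (f @* (conj_aut E @* S)) by rewrite !morphim_pgroup.
have iP : #|conj_aut E @* S : I| = #|f @* (conj_aut E @* S)|.
  rewrite card_morphim kf (setIidPr sPL) //.
have dvdp : #|S : E| %| p.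
  rewrite iSE iP; apply: (irreducible_psubgroup_card p_pr abV nVH cHV seH o3 irrV) => //.
  exact: morphimS.
(* Otherwise the inner automorphisms would form a Sylow [p]-subgroup of [AutF F E], and [p] would
   not divide the order of [OutF F E]. *)
have nt_iSE : #|S : E| != 1%N.
  rewrite iSE; apply/negP => /eqP/(index1g sIP) eIP.
  have [_ pM _] := seM.
  have sylP : p.-Sylow(L) (conj_aut E @* S).
    by rewrite -defP; have [_] := sylF E sES fnE.
  have [/andP[sMH _] _ _] := seM.
  have := dvdn_trans pM (cardSg sMH); rewrite card_quotient //.
  apply/negP; by rewrite -p'natE // eIP; case/and3P: sylP.
have iSEp : #|S : E| = p by apply/(prime_nt_dvdP p_pr).
split=> //; split.
- exact: stable_refl sLA.
- by rewrite -oV.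
- move=> U stU sPU sUE; have [_ minV] := mingroupP irrV.
  have nhU : H \subset 'N(h @* U).
    apply/subsetP => _ /morphimP[a _ La ->]; rewrite inE;
      apply/subsetP => _ /imsetP[_ /morphimP[u Eu Uu ->] ->].
    by rewrite -hf //; have Uau := stableP _ _ stU a La u Uu; rewrite mem_morphim // (subsetP sUE).
  have [hU1 | nthU] := eqVneq (h @* U) 1.
    left; apply/eqP; rewrite eqEsubset sPU andbT -kh ker_trivg_morphim sUE hU1.
    exact: subxx.
  right; have hUV : h @* U = V by apply: minV; rewrite ?nthU ?morphimS.
  apply/eqP; rewrite eqEsubset sUE /= -(morphimSGK (f := h)) ?kh //.
  by rewrite hUV; exact: subxx.
have [s Ss Is] : exists2 s, s \in S & conj_aut E s \notin I.
  have : ~~ (conj_aut E @* S \subset I) by rewrite -indexg_eq1 -iSE.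
  by case/subsetPn => _ /morphimP[s _ Ss ->] Is; exists s.
have Ns := subsetP nES s Ss.
have Las : conj_aut E s \in L by apply: (subsetP sPL); exact: mem_morphim.
have Hfs : f (conj_aut E s) \in H by rewrite mem_morphim.
have pfs : p.-elt (f (conj_aut E s)).
  by apply: mem_p_elt pP _; rewrite mem_morphim ?mem_morphim.
have ntfs : f (conj_aut E s) != 1.
  by apply: contra Is => /eqP f1; rewrite -[gval I]kf; apply/kerP.
have [_ /morphimP[e _ Ee ->]] := irreducible_nonquadratic p_pr abV nVH cHV seH o3 irrV Hfs pfs ntfs.
have hR d : d \in E -> h [~ d, s] = [~ h d, f (conj_aut E s)].
  move=> Ed; rewrite !commgEl -hf // norm_conj_autE // morphM ?groupV ?memJ_norm // morphV //.
move=> nt; apply/negP => sub; case/negP: nt; apply/eqP.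
have Ees : [~ e, s] \in E by rewrite commgEl groupM ?groupV ?memJ_norm.
rewrite -!hR //; apply/kerP; first by rewrite commgEl groupM ?groupV ?memJ_norm.
by rewrite kh; apply: (subsetP sub); rewrite !mem_commg.
Qed.
End Essential.

(** * Two essential subgroups normalized by S *)

Lemma F_characteristic_norm (gT : finGroupType) (S E : {group gT}) (F : fmor gT) :
  is_fusion_system S F -> E \subset S -> F_characteristic S F E -> S \subset 'N(E).
Proof.
case=> _ _ conjF _ _ sES chE; apply/subsetP => s Ss; rewrite inE.
rewrite -{2}(chE _ (conjF S s (subxx S) Ss)); apply/subsetP => _ /imsetP[x Ex ->].
by apply/imsetP; exists x; rewrite ?ffunE.
Qed.

Theorem theorem1p17 (gT : finGroupType) (p : nat) (S : {group gT})
    (F : {set gT} -> {ffun gT -> gT} -> bool) (E1 E2 : {group gT}) :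
  prime p -> odd p -> p.-group S -> saturated p S F ->
  E1 != E2 ->
  is_essential p S F E1 -> is_essential p S F E2 ->
  F_characteristic S F E1 -> F_characteristic S F E2 ->
  sectional_rank_le E1 3 -> sectional_rank_le E2 3 ->
  (Opprime p (OutF F E1) \isog SL2 p)%g \/ (Opprime p (OutF F E2) \isog SL2 p)%g.
Proof.
move=> p_pr p_odd pS satF neqE ess1 ess2 ch1 ch2 rk1 rk2.
have [fusF _ _] := satF.
have [sE1 _ _ _] := ess1; have [sE2 _ _ _] := ess2.
have nE1 := F_characteristic_norm fusF sE1 ch1.
have nE2 := F_characteristic_norm fusF sE2 ch2.
have [|[i1 j1]] := essential_SL2_or_jordan p_pr pS satF ess1 nE1 rk1; first by left.
have [|[i2 j2]] := essential_SL2_or_jordan p_pr pS satF ess2 nE2 rk2; first by right.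
have sAut E : AutF F E \subset Aut E by apply/subsetP => a /setIdP[].
have sS (E : {group gT}) : E \subset S -> S \subset 'N(E) -> conj_aut E @: S \subset AutF F E.
  move=> sES nES; rewrite -(morphimEsub (conj_aut_morphism E) nES) -AutS_conj_aut //.
  exact: (AutS_sub_AutF satF).
case: (no_jordan_amalgam p_pr p_odd pS sE1 sE2 i1 i2 neqE (sAut E1) (sAut E2)
         (sS _ sE1 nE1) (sS _ sE2 nE2) rk1 rk2 j1 j2).
Qed.
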